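(* Let $N\ge1$, $m,m_1,\dots,m_N\ge1$ be integers, $D^{(t)}\in\mathbb{R}^{m\times m_t}$ given matrices, and $\bm{a}^{(t)}\in\mathbb{R}^{m_t}$ with $\bm{a}^{(t)}\ge0$, $\bm{e}_{m_t}^\top\bm{a}^{(t)}=1$ ($t=1,\dots,N$). Consider the primal problem $$(\mathrm{P})\quad \min_{\bm{w},\{\Pi^{(t)}\}}\ \delta_{\Delta_m}(\bm{w})+\sum_{t}\delta^t_+(\Pi^{(t)})+\sum_t\langle D^{(t)},\Pi^{(t)}\rangle\ \ \text{s.t.}\ \ \Pi^{(t)}\bm{e}_{m_t}=\bm{w},\ (\Pi^{(t)})^\top\bm{e}_m=\bm{a}^{(t)},\ t=1,\dots,N,$$ and the problem $$(\mathrm{D})\quad \min_{\bm{u},\{V^{(t)}\},\{\bm{y}^{(t)}\},\{\bm{z}^{(t)}\}}\ \delta^*_{\Delta_m}(\bm{u})+\sum_t\delta^t_+(V^{(t)})+\sum_t\langle\bm{z}^{(t)},\bm{a}^{(t)}\rangle\ \ \text{s.t.}\ \ \sum_t\bm{y}^{(t)}-\bm{u}=0,\ \ V^{(t)}-D^{(t)}-\bm{y}^{(t)}\bm{e}_{m_t}^\top-\bm{e}_m(\bm{z}^{(t)})^\top=0\ \ \forall t,$$ with $\bm{u},\bm{y}^{(t)}\in\mathbb{R}^m$, $V^{(t)}\in\mathbb{R}^{m\times m_t}$, $\bm{z}^{(t)}\in\mathbb{R}^{m_t}$. For $\beta>0$ define the augmented Lagrangian $$\mathcal{L}_\beta(\bm{u},\{V^{(t)}\},\{\bm{y}^{(t)}\},\{\bm{z}^{(t)}\};\bm{\lambda},\{\Lambda^{(t)}\})=\delta^*_{\Delta_m}(\bm{u})+\sum_t\delta^t_+(V^{(t)})+\sum_t\langle\bm{z}^{(t)},\bm{a}^{(t)}\rangle+\langle\bm{\lambda},\textstyle\sum_t\bm{y}^{(t)}-\bm{u}\rangle$$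 $$+\sum_t\langle\Lambda^{(t)},R^{(t)}\rangle+\tfrac{\beta}{2}\|\textstyle\sum_t\bm{y}^{(t)}-\bm{u}\|^2+\tfrac{\beta}{2}\sum_t\|R^{(t)}\|_F^2,\qquad R^{(t)}:=V^{(t)}-D^{(t)}-\bm{y}^{(t)}\bm{e}_{m_t}^\top-\bm{e}_m(\bm{z}^{(t)})^\top.$$ Let $\beta>0$, $\tau\in(0,\frac{1+\sqrt5}{2})$, and starting from arbitrary $\bm{u}^0,\bm{\lambda}^0,\bm{y}^{(t),0}\in\mathbb{R}^m$, $\bm{z}^{(t),0}\in\mathbb{R}^{m_t}$, $V^{(t),0}\in\mathbb{R}^{m\times m_t}_+$, $\Lambda^{(t),0}\in\mathbb{R}^{m\times m_t}$, generate for $k=0,1,2,\dots$: (1) $(\bm{u}^{k+1},\{V^{(t),k+1}\})=\arg\min_{\bm{u},\{V^{(t)}\}}\mathcal{L}_\beta(\bm{u},\{V^{(t)}\},\{\bm{y}^{(t),k}\},\{\bm{z}^{(t),k}\};\bm{\lambda}^k,\{\Lambda^{(t),k}\})$; (2a) $\{\tilde{\bm{z}}^{(t),k+1}\}=\arg\min_{\{\bm{z}^{(t)}\}}\mathcal{L}_\beta(\bm{u}^{k+1},\{V^{(t),k+1}\},\{\bm{y}^{(t),k}\},\{\bm{z}^{(t)}\};\bm{\lambda}^k,\{\Lambda^{(t),k}\})$; (2b) $\{\bm{y}^{(t),k+1}\}=\arg\min_{\{\bm{y}^{(t)}\}}\mathcal{L}_\beta(\bm{u}^{k+1},\{V^{(t),k+1}\},\{\bm{y}^{(t)}\},\{\tilde{\bm{z}}^{(t),k+1}\};\bm{\lambda}^k,\{\Lambda^{(t),k}\})$;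 (2c) $\{\bm{z}^{(t),k+1}\}=\arg\min_{\{\bm{z}^{(t)}\}}\mathcal{L}_\beta(\bm{u}^{k+1},\{V^{(t),k+1}\},\{\bm{y}^{(t),k+1}\},\{\bm{z}^{(t)}\};\bm{\lambda}^k,\{\Lambda^{(t),k}\})$; (3) $\bm{\lambda}^{k+1}=\bm{\lambda}^k+\tau\beta(\sum_t\bm{y}^{(t),k+1}-\bm{u}^{k+1})$ and $\Lambda^{(t),k+1}=\Lambda^{(t),k}+\tau\beta(V^{(t),k+1}-D^{(t)}-\bm{y}^{(t),k+1}\bm{e}_{m_t}^\top-\bm{e}_m(\bm{z}^{(t),k+1})^\top)$, $t=1,\dots,N$. Then the sequence $\{(\bm{u}^k,\{V^{(t),k}\},\{\bm{y}^{(t),k}\},\{\bm{z}^{(t),k}\})\}$ converges to an optimal solution of (D), and the sequence $\{(\bm{\lambda}^k,\{\Lambda^{(t),k}\})\}$ converges to an optimal solution of (P) (with $\bm{\lambda}$ playing the role of $\bm{w}$ and $\Lambda^{(t)}$ that of $\Pi^{(t)}$).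
   Context: $\bm{e}_k$ is the all-ones vector in $\mathbb{R}^k$; $\Delta_m=\{\bm{w}\in\mathbb{R}^m:\bm{e}_m^\top\bm{w}=1,\bm{w}\ge0\}$; $\delta_{\Delta_m}$ is its indicator function and $\delta^*_{\Delta_m}(\bm{u})=\max_i u_i$ its convex conjugate; $\delta^t_+$ is the indicator function of the entrywise nonnegative matrices in $\mathbb{R}^{m\times m_t}$. $\langle X,Y\rangle=\sum_{ij}x_{ij}y_{ij}$, $\|\cdot\|_F$ the Frobenius norm. All minimizers in steps (1)–(2c) exist and are unique. *)

(* Defs.v *)
From HB Require Import structures.
From mathcomp Require Import all_boot all_order all_algebra.
From mathcomp Require Import all_classical all_reals all_analysis.
Set Implicit Arguments. Unset Strict Implicit. Unset Printing Implicit Defensive.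
Import Order.TTheory GRing.Theory Num.Theory.
Import numFieldNormedType.Exports.
Local Open Scope ring_scope.

Section Defs.
Variable R : realType.

Definition ones (k : nat) : 'cV[R]_k := const_mx 1.

Definition mxdot (p q : nat) (X Y : 'M[R]_(p, q)) : R :=
  \sum_(i < p) \sum_(j < q) X i j * Y i j.

Definition frob2 (p q : nat) (X : 'M[R]_(p, q)) : R := mxdot X X.

Definition in_simplex (m : nat) (w : 'cV[R]_m) : Prop :=
  ((ones m)^T *m w) ord0 ord0 = 1 /\ forall i, 0 <= w i ord0.

Definition mx_nonneg (p q : nat) (X : 'M[R]_(p, q)) : Prop :=
  forall i j, 0 <= X i j.

Definition indic (P : Prop) : \bar R := if `[< P >] then 0%E else +oo%E.

Definition delta_simplex (m : nat) (w : 'cV[R]_m) : \bar R := indic (in_simplex w).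

Definition delta_plus (p q : nat) (X : 'M[R]_(p, q)) : \bar R := indic (mx_nonneg X).

Definition delta_simplex_conj (m : nat) (u : 'cV[R]_m) : \bar R :=
  \big[Order.max/-oo%E]_(i < m) (u i ord0)%:E.

Definition resid (m n : nat) (D V : 'M[R]_(m, n)) (y : 'cV[R]_m) (z : 'cV[R]_n)
  : 'M[R]_(m, n) := V - D - y *m (ones n)^T - ones m *m z^T.

Variables (N m : nat) (ms : 'I_N -> nat).
Variables (D : forall t, 'M[R]_(m, ms t)) (a : forall t, 'cV[R]_(ms t)).

Definition objP (w : 'cV[R]_m) (Pi : forall t, 'M[R]_(m, ms t)) : \bar R :=
  (delta_simplex w + \sum_(t < N) delta_plus (Pi t)
   + (\sum_(t < N) mxdot (D t) (Pi t))%:E)%E.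

Definition feasP (w : 'cV[R]_m) (Pi : forall t, 'M[R]_(m, ms t)) : Prop :=
  forall t, Pi t *m ones (ms t) = w /\ (Pi t)^T *m ones m = a t.

Definition optimalP w Pi : Prop :=
  feasP w Pi /\ forall w' Pi', feasP w' Pi' -> (objP w Pi <= objP w' Pi')%E.

Definition objD (u : 'cV[R]_m) (V : forall t, 'M[R]_(m, ms t))
  (z : forall t, 'cV[R]_(ms t)) : \bar R :=
  (delta_simplex_conj u + \sum_(t < N) delta_plus (V t)
   + (\sum_(t < N) mxdot (z t) (a t))%:E)%E.

Definition feasD (u : 'cV[R]_m) (V : forall t, 'M[R]_(m, ms t))
  (y : forall t, 'cV[R]_m) (z : forall t, 'cV[R]_(ms t)) : Prop :=
  \sum_(t < N) y t - u = 0 /\ forall t, resid (D t) (V t) (y t) (z t) = 0.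

Definition optimalD u V y z : Prop :=
  feasD u V y z /\
  forall u' V' y' z', feasD u' V' y' z' -> (objD u V z <= objD u' V' z')%E.

Definition Lbeta (beta : R) (u : 'cV[R]_m) (V : forall t, 'M[R]_(m, ms t))
  (y : forall t, 'cV[R]_m) (z : forall t, 'cV[R]_(ms t))
  (lam : 'cV[R]_m) (Lam : forall t, 'M[R]_(m, ms t)) : \bar R :=
  (delta_simplex_conj u + \sum_(t < N) delta_plus (V t)
   + (\sum_(t < N) mxdot (z t) (a t)
      + mxdot lam (\sum_(t < N) y t - u)
      + \sum_(t < N) mxdot (Lam t) (resid (D t) (V t) (y t) (z t))
      + beta / 2 * frob2 (\sum_(t < N) y t - u)
      + beta / 2 * \sum_(t < N) frob2 (resid (D t) (V t) (y t) (z t)))%:E)%E.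

End Defs.
Arguments ones {R} k.

(* Main.v *)
(* The dual block [(u, V)] and the block [(y, z)] make (D) a two-block problem. The sweep
   z, y, z equals a joint minimisation in [(y, z)] with an extra proximal term that is a
   multiple of [(sum_i dy t i) ^ 2] for each [t], so the method is a semi-proximal ADMM.
   For any KKT point (one exists by linear programming duality, via Farkas' lemma) the merit
   function [lyap] decreases along the iterates as soon as [tau ^ 2 < tau + 1]. Hence the
   residuals and the increments vanish and the iterates are bounded, because the constraint
   map of [(y, z)] together with the proximal seminorm is injective. Every cluster point is
   a KKT point; the merit function centred at it is nonincreasing and has a subsequential
   limit 0, so the whole sequence converges to it. Cluster points are taken along an
   ultrafilter, which makes all bounded coordinate sequences converge simultaneously. *)

Require Import Defs.
From HB Require Import structures.
From mathcomp Require Import all_boot all_order all_algebra.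
From mathcomp Require Import all_classical all_reals all_analysis.
From mathcomp Require Import ring lra.
Set Implicit Arguments. Unset Strict Implicit. Unset Printing Implicit Defensive.
Import Order.TTheory GRing.Theory Num.Theory.
Import numFieldNormedType.Exports.
Local Open Scope ring_scope.
Local Open Scope classical_set_scope.

(** * Linear programming duality *)

(** The constraints of (D) do not determine [(y, z)]: adding constants [s t] with total 0 to the
    [y t] and subtracting them from the matching entries of [z] changes neither the residuals nor
    the objective. With several plans the optimal set of (D) is therefore unbounded, and estimates
    of residuals alone say nothing about these shifts. The proximal term hidden in the sweep
    measures exactly the missing quantities [sum_i y t i]; this is why the merit function carries
    the errors of these sums and their last increments. The merit function is centred at a KKT
    point, so one must be known before any bound on the iterates is available; hence the need for
    linear programming duality with attainment on both sides. *)

Lemma scalar_fun0 (R : pzRingType) (V : lmodType R) (h : V -> R) : scalar h -> h 0 = 0.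
Proof. by move=> hl; have := hl (-1) 0 0; rewrite scaler0 addr0 mulN1r addNr. Qed.

Lemma scalar_funZ (R : pzRingType) (V : lmodType R) (h : V -> R) :
  scalar h -> forall b x, h (b *: x) = b * h x.
Proof.
by move=> hl b x; have := hl b x 0; rewrite !addr0 => ->; rewrite scalar_fun0 // addr0.
Qed.

(* Bartl's induction: if the last functional [h] is needed, some [x0] satisfies the other
   constraints with [g x0 < 0 > h x0], and substituting [x - (h x / h x0) x0] for [x]
   makes [h] vanish. *)
Lemma farkas (R : realFieldType) (V : lmodType R) (n : nat) (f : 'I_n -> V -> R)
    (g : V -> R) :
  (forall k, scalar (f k)) -> scalar g ->
  (forall x, (forall k, 0 <= f k x) -> 0 <= g x) ->
  exists c : 'I_n -> R, (forall k, 0 <= c k) /\ forall x, g x = \sum_k c k * f k x.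
Proof.
elim: n f g => [|n IH] f g lf lg fg.
  exists (fun=> 0); split=> // x; rewrite big_ord0; apply/eqP; rewrite eq_le.
  have hx : 0 <= g x by apply: fg => -[].
  have hN : 0 <= g (-1 *: x) by apply: fg => -[].
  by rewrite hx andbT; rewrite scalar_funZ // in hN; lra.
pose f' k := f (widen_ord (leqnSn n) k); pose h := f ord_max.
have [A|/existsNP[x0 /not_implyP[fx0 /negP]]] :=
    pselect (forall x, (forall k, 0 <= f' k x) -> 0 <= g x).
  have [c [c0 cE]] := IH f' g (fun k => lf _) lg A.
  exists (fun k => if unlift ord_max k is Some j then c j else 0).
  split=> [k|x]; first by case: unliftP.
  rewrite big_ord_recr /= unlift_none mul0r addr0 cE.
  apply: eq_bigr => k _; congr (_ * _).
  case: unliftP => [j|] /(congr1 val) /=.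
    by rewrite /bump leqNgt ltn_ord /= => /val_inj ->.
  by move=> kn; have := ltn_ord k; rewrite kn ltnn.
rewrite -ltNge => gx0.
have lh : scalar h := lf _.
have hx0 : h x0 < 0.
  rewrite ltNge; apply/negP => h0; move: gx0; rewrite ltNge fg // => k.
  have [kn|] := ltnP k n; last rewrite leq_eqVlt ltnNge -ltnS ltn_ord orbF => /eqP kn.
    by have := fx0 (Ordinal kn); congr (_ <= f _ _); apply: val_inj.
  by move: h0; congr (_ <= f _ _); apply: val_inj.
pose p x := - (h x / h x0) *: x0 + x.
have lcomp (q : V -> R) : scalar q -> forall x, q (p x) = q x - h x / h x0 * q x0.
  by move=> lq x; rewrite lq; ring.
have [||x|c [c0 cE]] := IH (fun k => f' k \o p) (g \o p).
- move=> k b x z /=; rewrite !(lcomp (f' k) (lf _)) /f' lf lh; ring.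
- move=> b x z /=; rewrite !(lcomp g) // lg lh; ring.
- move=> fx; apply: fg => k /=.
  have [kn|] := ltnP k n; last rewrite leq_eqVlt ltnNge -ltnS ltn_ord orbF => /eqP kn.
    by have := fx (Ordinal kn); congr (_ <= f _ _); apply: val_inj.
  have -> : k = ord_max by apply: val_inj.
  by rewrite -/h lcomp; [rewrite divfK ?lt_eqF ?subrr | exact: lf].
(* The wanted identity at [x0] forces this coefficient of [h]; it is nonnegative as a quotient of
   two negative numbers. *)
pose e := (g x0 - \sum_k c k * f' k x0) / h x0.
exists (fun k => if unlift ord_max k is Some j then c j else e).
have e0 : 0 <= e.
  rewrite -[e]mulrNN -invrN divr_ge0 ?oppr_ge0 ?ltW // subr_lt0.
  by apply: lt_le_trans gx0 _; apply: sumr_ge0 => k _; rewrite mulr_ge0.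
split=> [k|x]; first by case: unliftP.
rewrite big_ord_recr /= unlift_none.
under eq_bigr => k _.
  have -> : unlift ord_max (widen_ord (leqnSn n) k) = Some k.
    case: unliftP => [j|] /(congr1 val) /=.
      by rewrite /bump leqNgt ltn_ord /= => /val_inj ->.
    by move=> kn; have := ltn_ord k; rewrite kn ltnn.
  over.
have := cE x; rewrite /= lcomp // => gE.
rewrite -[LHS](subrK (h x / h x0 * g x0)) gE.
under eq_bigr => k _ do rewrite (lcomp (f' k) (lf _)) mulrBr.
rewrite big_split /= -addrA; congr (_ + _).
rewrite sumrN; under eq_bigr => k _ do rewrite mulrCA.
rewrite -mulr_sumr /e -/h; ring.
Qed.

Lemma farkas_fin (R : realFieldType) (V : lmodType R) (K : finType) (f : K -> V -> R)
    (g : V -> R) :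
  (forall k, scalar (f k)) -> scalar g ->
  (forall x, (forall k, 0 <= f k x) -> 0 <= g x) ->
  exists c : K -> R, (forall k, 0 <= c k) /\ forall x, g x = \sum_k c k * f k x.
Proof.
move=> lf lg fg.
have [||c [c0 cE]] := @farkas R V #|K| (f \o enum_val) g _ lg.
- by move=> k; apply: lf.
- by move=> x fx; apply: fg => k; rewrite -(enum_rankK k); apply: fx.
exists (c \o enum_rank); split=> [k|x] /=; first exact: c0.
rewrite cE (reindex enum_rank) /=; last by apply/onW_bij/enum_rank_bij.
by apply: eq_bigr => k _; rewrite enum_rankK.
Qed.

Lemma big_option (R : nmodType) (K : finType) (F : option K -> R) :
  \sum_k F k = F None + \sum_k F (Some k).
Proof.
by rewrite ![index_enum _]unlock [@Finite.enum in LHS]unlock /= big_cons big_map.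
Qed.

(** Farkas' lemma is used twice on the homogenised cone in [V * R]. The first use yields multipliers
    certifying the infimum [v]; the second refutes non-attainment, since its certificate would raise
    the lower bound strictly above [v]. Complementarity then holds because nonnegative terms sum to
    a zero gap. *)
Lemma lp_strong_duality (R : realType) (V : lmodType R) (K : finType) (f : K -> V -> R)
    (b : K -> R) (g : V -> R) (x0 : V) (v0 : R) :
  (forall k, scalar (f k)) -> scalar g ->
  (forall k, b k <= f k x0) ->
  (forall x, (forall k, b k <= f k x) -> v0 <= g x) ->
  exists (x : V) (c : K -> R),
    [/\ forall k, b k <= f k x, forall k, 0 <= c k,
        forall x', g x' = \sum_k c k * f k x'
      & forall k, c k * (f k x - b k) = 0].
Proof.
move=> lf lg fx0 gv0.
pose S := [set g x | x in [set x | forall k, b k <= f k x]].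
pose v := inf S.
have Sinf : has_inf S.
  split; first by exists (g x0); exists x0.
  by exists v0 => _ [x fx <-]; apply: gv0.
have vle x : (forall k, b k <= f k x) -> v <= g x.
  by move=> fx; apply: (ge_inf Sinf.2); exists x.
(* Points [(x, t)] with [t > 0] stand for [x / t], those with [t = 0] for recession directions. [F0]
   is a slot for one more constraint; [e] and [d] are the multipliers of [F0] and of [0 <= t]. *)
have hom (F0 G : V * R^o -> R) : scalar F0 -> scalar G ->
    (forall p, (forall k, b k * p.2 <= f k p.1) -> 0 <= p.2 -> 0 <= F0 p -> 0 <= G p) ->
    exists c e d, [/\ forall k : K, 0 <= c k, 0 <= e, 0 <= d
      & forall p, G p = (\sum_k c k * (f k p.1 - b k * p.2)) + e * F0 p + d * p.2].
  move=> lF0 lG FG.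
  pose F (k : option (option K)) (p : V * R^o) :=
    match k with Some (Some k) => f k p.1 - b k * p.2 | Some None => F0 p | None => p.2 end.
  have lF k : scalar (F k).
    case: k => [[k|]|] d x z //=; [rewrite lf /GRing.scale /=; ring | exact: lF0].
  have [||c [c0 cE]] := @farkas_fin R (V * R^o)%type _ F G lF => //.
    move=> p Fp; apply: FG => [k||].
    + by have := Fp (Some (Some k)); rewrite /= subr_ge0.
    + exact: (Fp None).
    + exact: (Fp (Some None)).
  exists (c \o Some \o Some), (c (Some None)), (c None); split=> [k|||p] //=.
  by rewrite cE !big_option /= addrC (addrC (c (Some None) * _)).
have [|||c [e [d [c0 e0 d0 cE]]]] := @hom (fun=> 0) (fun p => g p.1 - v * p.2).
- by move=> ? ? ?; rewrite mulr0 addr0.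
- by move=> q x z; rewrite /= lg /GRing.scale /=; ring.
- move=> [x t] /= fx t0 _; rewrite subr_ge0.
  have [t0'|tN0] := eqVneq t 0.
    rewrite t0' mulr0 leNgt; apply/negP => gx.
    (* Moving from [x0] by [q] times a recession direction with [g x < 0] brings [g] to exactly
       [v - 1], below the infimum. *)
    pose q := (g x0 - v + 1) / - g x.
    have q0 : 0 <= q by rewrite divr_ge0 ?oppr_ge0 ?ltW //; have := vle x0 fx0; lra.
    have : v <= g (q *: x + x0).
      apply: vle => k; rewrite lf -[b k]add0r lerD // mulr_ge0 //.
      by have := fx k; rewrite t0' mulr0.
    have qE : q * g x = - (g x0 - v + 1).
      by rewrite /q invrN mulrN mulNr divfK // lt_eqF.
    by rewrite lg qE; lra.
  have tp : 0 < t by rewrite lt_def tN0.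
  have : v <= g (t^-1 *: x).
    by apply: vle => k; rewrite scalar_funZ // ler_pdivlMl // mulrC.
  by rewrite scalar_funZ // ler_pdivlMl // mulrC.
have gE x : g x = \sum_k c k * f k x.
  have := cE (x, 0); rewrite /= !mulr0 !addr0 subr0 => ->.
  by apply: eq_bigr => k _; rewrite mulr0 subr0.
have vE : v <= \sum_k c k * b k.
  have := cE (0, 1); rewrite /= scalar_fun0 // !mulr1 mulr0 addr0.
  under eq_bigr => k _ do rewrite scalar_fun0 // mulr1 sub0r mulrN.
  by rewrite sumrN; lra.
have [x [fx gx]] : exists x, (forall k, b k <= f k x) /\ g x <= v.
  apply: contrapT => H.
  (* Without a feasible point of value at most [v], the constraint [g p.1 <= v * p.2] would force
     [p.2 <= 0] on the cone. The certificate of this gives [1 + e' * v <= e' * g x] for feasible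
     [x], so [v + e'^-1] would be a lower bound. *)
  have [|||c' [e' [d' [c0' e0' d0' cE']]]] := @hom (fun p => v * p.2 - g p.1) (fun p => - p.2).
  - by move=> q x z; rewrite /= lg /GRing.scale /=; ring.
  - by move=> q x z; rewrite /= /GRing.scale /=; ring.
  - move=> [x t] /= fx t0 gx; rewrite oppr_ge0 leNgt; apply/negP => tp; apply: H.
    exists (t^-1 *: x); split=> [k|].
      by rewrite scalar_funZ // ler_pdivlMl // mulrC.
    by rewrite scalar_funZ // ler_pdivrMl // mulrC -subr_ge0.
  have sE x : \sum_k c' k * f k x = e' * g x.
    have := cE' (x, 0); rewrite /= !mulr0 oppr0 addr0 sub0r mulrN => /eqP.
    rewrite eq_sym subr_eq0 => /eqP <-.
    by apply: eq_bigr => k _; rewrite mulr0 subr0.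
  have sb : \sum_k c' k * b k = 1 + e' * v + d'.
    have := cE' (0, 1); rewrite /= scalar_fun0 // !mulr1 subr0.
    under eq_bigr => k _ do rewrite scalar_fun0 // mulr1 sub0r mulrN.
    by rewrite sumrN; lra.
  have ge x : (forall k, b k <= f k x) -> 1 + e' * v <= e' * g x.
    move=> fx; rewrite -sE -[leLHS]addr0 -[X in _ + X](subrr d') addrA -sb lerBlDr.
    by rewrite ler_wpDr // ler_sum // => k _; rewrite ler_wpM2l.
  have e0'' : 0 < e'.
    rewrite lt_def e0' andbT; apply/eqP => e'0.
    by have := ge x0 fx0; rewrite e'0 !mul0r; lra.
  have : v + e'^-1 <= v.
    apply: lb_le_inf; first by exists (g x0); exists x0.
    move=> _ [x fx <-]; rewrite -(ler_pM2l e0'') mulrDr mulfV ?gt_eqF // addrC.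
    exact: ge.
  by rewrite gerDl leNgt invr_gt0 e0''.
exists x, c; split=> // k; apply/eqP.
have kp j : 0 <= c j * (f j x - b j) by rewrite mulr_ge0 // subr_ge0.
have : \sum_j c j * (f j x - b j) = 0.
  apply/eqP; rewrite eq_le sumr_ge0 // andbT.
  under eq_bigr => j _ do rewrite mulrBr.
  by rewrite sumrB -gE; lra.
by move/eqP; rewrite psumr_eq0 // => /allP/(_ k (mem_index_enum _)).
Qed.

(** * The merit function *)

(** [l] is the multiplier error, [r] the residual, [g] the image of the [(y, z)]-error under the
    constraint map, [s] and [s0] the current and previous errors of the sums [sum_i y t i]. The
    [r]-term, with Young weight [th], pays for a cross term that appears when [tau] differs from
    1. *)
Definition lyap (R : realFieldType) (K T : finType) (w : T -> R) (beta tau th : R)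
    (l r g : K -> R) (s s0 : T -> R) : R :=
  \sum_k ((tau * beta)^-1 * l k ^+ 2 + beta * g k ^+ 2
          + `|1 - tau| * th * beta * r k ^+ 2)
  + \sum_t w t * (s t ^+ 2 + (s t - s0 t) ^+ 2).

(** The three relations are monotonicity of the first block ([r' - g'] is its share of the
    residual), stationarity of the second block tested with the error [g'], and the difference of
    two consecutive stationarity conditions tested with the increment [g' - g]. Twice their sum
    completes the squares, up to the cross term [2 * (1 - tau) * (r k * (g' k - g k))], split by
    Young's inequality, and a dropped square of the second difference of [s]. *)
Lemma lyap_descent (R : realFieldType) (K T : finType) (w : T -> R) (beta tau th : R)
    (l r g l' r' g' : K -> R) (s0 s s' : T -> R) :
  0 < beta -> 0 < tau -> 0 < th -> (forall t, 0 <= w t) ->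
  \sum_k (r' k - g' k) * (l k + beta * r' k - beta * (g' k - g k)) <= 0 ->
  \sum_k g' k * (l k + beta * r' k) + \sum_t w t * (s' t * (s' t - s t)) = 0 ->
  \sum_k beta * (r' k - (1 - tau) * r k) * (g' k - g k)
    + \sum_t w t * ((s' t - s t) * ((s' t - s t) - (s t - s0 t))) = 0 ->
  (forall k, l' k = l k + tau * beta * r' k) ->
  lyap w beta tau th l' r' g' s' s
  + (\sum_k beta * ((2 - tau - `|1 - tau| * th) * r' k ^+ 2
                   + (1 - `|1 - tau| / th) * (g' k - g k) ^+ 2)
     + \sum_t w t * (s' t - s t) ^+ 2)
  <= lyap w beta tau th l r g s s0.
Proof.
move=> b0 t0 th0 w0 H1 H2 H3 lE; rewrite /lyap.
have amgm x y : 2 * (1 - tau) * (x * y) <= `|1 - tau| * (th * x ^+ 2 + th^-1 * y ^+ 2).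
  have sq (d : R) : d ^+ 2 = 1 -> 0 <= th * x ^+ 2 + th^-1 * y ^+ 2 + 2 * d * (x * y).
    move=> d2; have -> : th * x ^+ 2 + th^-1 * y ^+ 2 + 2 * d * (x * y)
        = th^-1 * (th * x + d * y) ^+ 2.
      by rewrite sqrrD exprMn exprMn d2; field; rewrite gt_eqF.
    by rewrite mulr_ge0 ?invr_ge0 ?sqr_ge0 // ltW.
  have := sq 1 (expr1n _ _); have := sq (-1) (etrans (sqrrN _) (expr1n _ _)).
  case: (ger0P (1 - tau)) => ht hN hP.
    by have := mulr_ge0 ht hN; lra.
  have nt : 0 <= - (1 - tau) by lra.
  by have := mulr_ge0 nt hP; lra.
have K_part : forall k,
    ((tau * beta)^-1 * l' k ^+ 2 + beta * g' k ^+ 2 + `|1 - tau| * th * beta * r' k ^+ 2)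
    + beta * ((2 - tau - `|1 - tau| * th) * r' k ^+ 2
              + (1 - `|1 - tau| / th) * (g' k - g k) ^+ 2)
    <= ((tau * beta)^-1 * l k ^+ 2 + beta * g k ^+ 2 + `|1 - tau| * th * beta * r k ^+ 2)
       + 2 * ((r' k - g' k) * (l k + beta * r' k - beta * (g' k - g k)))
       + 2 * (g' k * (l k + beta * r' k))
       + 2 * (beta * (r' k - (1 - tau) * r k) * (g' k - g k)).
  move=> k; have := amgm (r k) (g' k - g k); rewrite -(ler_pM2l b0) lE => H.
  rewrite -subr_ge0 in H; rewrite -subr_ge0; apply: le_trans H _.
  rewrite le_eqVlt; apply/orP; left; apply/eqP; field.
  by rewrite !gt_eqF.
have T_part : forall t,
    w t * (s' t ^+ 2 + (s' t - s t) ^+ 2) + w t * (s' t - s t) ^+ 2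
    <= w t * (s t ^+ 2 + (s t - s0 t) ^+ 2)
       + 2 * (w t * (s' t * (s' t - s t)))
       + 2 * (w t * ((s' t - s t) * ((s' t - s t) - (s t - s0 t)))).
  move=> t; have := mulr_ge0 (w0 t) (sqr_ge0 ((s' t - s t) - (s t - s0 t))).
  rewrite -subr_ge0 => H; rewrite -subr_ge0; apply: le_trans H _.
  by rewrite le_eqVlt; apply/orP; left; apply/eqP; ring.
have sum_le (J : finType) (A B : J -> R) :
    (forall i, A i <= B i) -> \sum_i A i <= \sum_i B i.
  by move=> AB; apply: ler_sum.
move/sum_le: K_part; move/sum_le: T_part; rewrite !big_split /= -!mulr_sumr => HT HK.
lra.
Qed.

Lemma le_sum_term (R : realFieldType) (K : finType) (F : K -> R) (k : K) :
  (forall j, 0 <= F j) -> F k <= \sum_j F j.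
Proof. by move=> F0; rewrite (bigD1 k) //= lerDl sumr_ge0. Qed.

Lemma lyap_ge (R : realFieldType) (K T : finType) (w : T -> R) (beta tau th : R)
    (l r g : K -> R) (s s0 : T -> R) :
  0 < beta -> 0 < tau -> 0 < th -> (forall t, 0 <= w t) ->
  let phi := lyap w beta tau th l r g s s0 in
  [/\ 0 <= phi, forall k, (tau * beta)^-1 * l k ^+ 2 <= phi,
      forall k, beta * g k ^+ 2 <= phi & forall t, w t * s t ^+ 2 <= phi].
Proof.
move=> b0 t0 th0 w0 phi.
have p1 x : 0 <= (tau * beta)^-1 * x ^+ 2.
  by rewrite mulr_ge0 ?sqr_ge0 // invr_ge0 ltW // mulr_gt0.
have p2 x : 0 <= beta * x ^+ 2 by rewrite mulr_ge0 ?sqr_ge0 // ltW.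
have p3 x : 0 <= `|1 - tau| * th * beta * x ^+ 2.
  by rewrite mulr_ge0 ?sqr_ge0 // !mulr_ge0 // ltW.
have q x t : 0 <= w t * x ^+ 2 by rewrite mulr_ge0 ?sqr_ge0.
have K0 k : 0 <= (tau * beta)^-1 * l k ^+ 2 + beta * g k ^+ 2
    + `|1 - tau| * th * beta * r k ^+ 2.
  by rewrite !addr_ge0.
have T0 t : 0 <= w t * (s t ^+ 2 + (s t - s0 t) ^+ 2) by rewrite mulrDr addr_ge0.
have SK : 0 <= \sum_k ((tau * beta)^-1 * l k ^+ 2 + beta * g k ^+ 2
    + `|1 - tau| * th * beta * r k ^+ 2) by apply: sumr_ge0.
have ST : 0 <= \sum_t w t * (s t ^+ 2 + (s t - s0 t) ^+ 2) by apply: sumr_ge0.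
rewrite /phi /lyap; split=> [|k|k|t]; first exact: addr_ge0.
- rewrite ler_wpDr //; apply: le_trans (le_sum_term k K0).
  by have := p2 (g k); have := p3 (r k); lra.
- rewrite ler_wpDr //; apply: le_trans (le_sum_term k K0).
  by have := p1 (l k); have := p3 (r k); lra.
- rewrite ler_wpDl //; apply: le_trans (le_sum_term t T0).
  by have := q (s t - s0 t) t; lra.
Qed.

(** For [tau] other than 1, [th] has to lie strictly between [|1 - tau|] and
    [(2 - tau) / |1 - tau|]. Such a number exists exactly when [(1 - tau) ^ 2 < 2 - tau], that is
    [tau ^ 2 < tau + 1]: this is the origin of the golden ratio. *)
Lemma golden_margin (R : realType) (tau : R) :
  0 < tau -> tau < (1 + Num.sqrt 5) / 2 ->
  exists th, [/\ 0 < th, 0 < 2 - tau - `|1 - tau| * th & 0 < 1 - `|1 - tau| / th].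
Proof.
move=> t0 tg; set c := `|1 - tau|.
have c0 : 0 <= c by exact: normr_ge0.
have cp : c ^+ 2 < 2 - tau.
  rewrite /c real_normK ?num_real //.
  have s5 : Num.sqrt 5 ^+ 2 = 5 :> R by rewrite sqr_sqrtr.
  have s1 : 1 <= Num.sqrt 5 :> R by rewrite -[leLHS]sqrtr1 ler_sqrt //; lra.
  have d1 : 0 < Num.sqrt 5 - (2 * tau - 1) by lra.
  have d2 : 0 < Num.sqrt 5 + (2 * tau - 1) by lra.
  by have := mulr_gt0 d1 d2; nra.
(* The excess over [c] is a fraction of the slack in [cp]; dividing by [2 * (c + 1)] rather than by
   a multiple of [c] covers [tau = 1], where [c = 0]. *)
exists (c + (2 - tau - c ^+ 2) / (2 * (c + 1))).
have q0 : 0 < (2 - tau - c ^+ 2) / (2 * (c + 1)).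
  by rewrite divr_gt0 ?mulr_gt0 ?subr_gt0 //; lra.
have qE : (2 - tau - c ^+ 2) / (2 * (c + 1)) * (2 * (c + 1)) = 2 - tau - c ^+ 2.
  by rewrite divfK // gt_eqF //; lra.
set q := _ / _ in q0 qE *; split; [lra | nra |].
by rewrite subr_gt0 ltr_pdivrMr; lra.
Qed.

(** * The transport problem on functions of finite index types *)

Section TransportProblem.
Variables (R : realType) (T I Z : finType) (tg : Z -> T) (D : Z -> I -> R) (a : Z -> R).

(** [T] indexes the plans, [I] their rows and [Z] the columns of all plans together, [tg c] being
    the plan that owns column [c]. Matrices of different widths thus become one function on [Z] and
    [I]. *)
Definition res0 (u : I -> R) (y : T -> I -> R) (i : I) : R := \sum_t y t i - u i.

Definition res (V : Z -> I -> R) (y : T -> I -> R) (z : Z -> R) (c : Z) (i : I) : R :=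
  V c i - D c i - y (tg c) i - z c.

(* [(l, L)] is, up to sign, a subgradient of the first block at [(u, V)]:
   [l] lies in the subdifferential of the maximum at [u], and [- L] in the normal cone
   of the nonnegative matrices at [V]. *)
Record subgrad (u : I -> R) (V : Z -> I -> R) (l : I -> R) (L : Z -> I -> R) : Prop := {
  subgrad_l_ge0 : forall i, 0 <= l i;
  subgrad_l_sum : \sum_i l i = 1;
  subgrad_u_le : forall i, u i <= \sum_j l j * u j;
  subgrad_V_ge0 : forall c i, 0 <= V c i;
  subgrad_L_ge0 : forall c i, 0 <= L c i;
  subgrad_compl : forall c i, L c i * V c i = 0 }.

(** [kkt_col] and [kkt_row] are stationarity in [z] and in [y], and at the same time the constraints
    of (P) for [(l, L)]. *)
Record kkt (u : I -> R) (V : Z -> I -> R) (y : T -> I -> R) (z : Z -> R)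
    (l : I -> R) (L : Z -> I -> R) : Prop := {
  kkt_subgrad :> subgrad u V l L;
  kkt_res0 : forall i, res0 u y i = 0;
  kkt_res : forall c i, res V y z c i = 0;
  kkt_col : forall c, \sum_i L c i = a c;
  kkt_row : forall t i, \sum_(c | tg c == t) L c i = l i }.

Lemma sum_delta (J : finType) (j : J) (F : J -> R) : \sum_k (k == j)%:R * F k = F j.
Proof.
rewrite (bigD1 j) //= eqxx mul1r big1 ?addr0 // => k /negPf ->.
by rewrite mul0r.
Qed.

Lemma sum_tg (y : T -> I -> R) (P : Z -> I -> R) :
  \sum_c \sum_i y (tg c) i * P c i = \sum_t \sum_i y t i * \sum_(c | tg c == t) P c i.
Proof.
rewrite (partition_big tg xpredT) //=; apply: eq_bigr => t _.
rewrite exchange_big /=; apply: eq_bigr => i _.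
by rewrite mulr_sumr; apply: eq_bigr => c /eqP ->.
Qed.

(** Each constraint of (D) is paired with its multiplier. Only equality constraints enter, so one
    side may be an arbitrary feasible point while the other belongs to a KKT point; this serves
    optimality in (D) as well as in (P). *)
Lemma duality_gap (u : I -> R) V y z (l : I -> R) L :
  (forall i, res0 u y i = 0) -> (forall c i, res V y z c i = 0) ->
  (forall c, \sum_i L c i = a c) ->
  (forall t i, \sum_(c | tg c == t) L c i = l i) ->
  \sum_c z c * a c + \sum_c \sum_i D c i * L c i
  = \sum_c \sum_i V c i * L c i - \sum_i u i * l i.
Proof.
move=> r0 r1 col row.
have -> : \sum_i u i * l i = \sum_c \sum_i y (tg c) i * L c i.
  rewrite sum_tg exchange_big /=; apply: eq_bigr => i _.
  under eq_bigr => t _ do rewrite row.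
  by rewrite -mulr_suml; have /eqP := r0 i; rewrite subr_eq0 => /eqP ->.
rewrite -sumrB -big_split /=; apply: eq_bigr => c _.
rewrite -col mulr_sumr -sumrB -big_split /=; apply: eq_bigr => i _.
have := r1 c i; rewrite /res => r; rewrite -[RHS]subr0 -[in RHS](mul0r (L c i)) -r; ring.
Qed.

(** * Existence of a KKT point *)

Hypothesis (a_ge0 : forall c, 0 <= a c) (a_sum : forall t, \sum_(c | tg c == t) a c = 1).
Hypothesis (I_gt0 : (0 < #|I|)%N).

(** The linear program minimises [s + sum_c a c * z c] under [s >= sum_t y t i] and [y + z >= - D]:
    the epigraph variable [s] replaces the maximum, and the equality constraints eliminate [u] and
    [V]. Its multipliers are [l] and [L]; the multiplier identity on unit vectors gives their row,
    column and total sums. *)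
Lemma kkt_exists : exists u V y z l L, kkt u V y z l L.
Proof.
(* Duality is stated over a single module, so [(y, z, s)] is stored as a row vector indexed by an
   enumeration of a disjoint union. *)
pose J := (T * I + (Z + unit))%type.
pose co (x : 'rV[R]_#|{: J}|) (j : J) : R := x ord0 (enum_rank j).
pose xy x t i := co x (inl (t, i)).
pose xz x c := co x (inr (inl c)).
pose xs x := co x (inr (inr tt)).
pose pack (y : T -> I -> R) (z : Z -> R) (s : R) : 'rV[R]_#|{: J}| :=
  \row_k match enum_val k with
    | inl p => y p.1 p.2 | inr (inl c) => z c | inr (inr _) => s end.
have packy y z s t i : xy (pack y z s) t i = y t i by rewrite /xy /co mxE enum_rankK.
have packz y z s c : xz (pack y z s) c = z c by rewrite /xz /co mxE enum_rankK.
have packs y z s : xs (pack y z s) = s by rewrite /xs /co mxE enum_rankK.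
have coD d x y j : co (d *: x + y) j = d * co x j + co y j by rewrite /co !mxE.
pose f (k : I + Z * I) x : R :=
  match k with
  | inl i => xs x - \sum_t xy x t i
  | inr p => xy x (tg p.1) p.2 + xz x p.1 end.
pose b (k : I + Z * I) : R := if k is inr p then - D p.1 p.2 else 0.
pose g x : R := xs x + \sum_c a c * xz x c.
have mN0 : #|I|%:R != 0 :> R by rewrite pnatr_eq0 -lt0n.
have summ (x : R) : \sum_(i : I) x / #|I|%:R = x.
  by rewrite sumr_const -mulrnAr -[_ *+ _]mulr_natr mulVf // mulr1.
have lf k : scalar (f k).
  case: k => [i|p] d x y; rewrite /f.
    rewrite [xs _]coD (eq_bigr (fun t => d * xy x t i + xy y t i)) => [|t _]; last exact: coD.
    rewrite -/(xs x) -/(xs y).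
    by rewrite big_split -mulr_sumr /=; ring.
  rewrite [xy _ _ _]coD [xz _ _]coD -/(xy x _ _) -/(xy y _ _) -/(xz x _) -/(xz y _); ring.
have lg : scalar g.
  move=> d x y; rewrite /g [xs _]coD -/(xs x) -/(xs y).
  rewrite (eq_bigr (fun c => d * (a c * xz x c) + a c * xz y c)) => [|c _].
    by rewrite big_split -mulr_sumr /=; ring.
  by rewrite [xz _ _]coD -/(xz x _) -/(xz y _); ring.
(* The point [x0] is feasible because [z] dominates [- D]. The bound [v0] is weak duality against
   the plans that spread each [a c] uniformly over the rows; their row sums agree because [a] has
   mass 1 on every plan. *)
have [||x [q [fx q0 gE qE]]] := lp_strong_duality (b := b)
    (x0 := pack (fun=> fun=> 0) (fun c => \sum_i `|D c i|) 0)
    (v0 := - \sum_c \sum_i a c / #|I|%:R * D c i) lf lg.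
- move=> [i|[c i]] /=.
    by rewrite packs big1 ?subrr // => t _; rewrite packy.
  rewrite packy packz add0r (bigD1 i) //= (le_trans (ler_norm _)) // normrN lerDl.
  by apply: sumr_ge0.
- move=> x fx; rewrite /g; pose y := xy x; pose z := xz x; pose s := xs x.
  rewrite -/s -/z.
  have -> : s + \sum_c a c * z c =
     \sum_i (s - \sum_t y t i) / #|I|%:R
     + \sum_c \sum_i a c / #|I|%:R * (y (tg c) i + z c).
    under [X in _ = _ + X]eq_bigr => c _ do
      (under eq_bigr => i _ do rewrite mulrDr mulrC; rewrite big_split /=).
    rewrite big_split /= sum_tg -mulr_suml sumrB sumr_const.
    have -> : \sum_t \sum_i y t i * (\sum_(c | tg c == t) a c / #|I|%:R)
        = (\sum_i \sum_t y t i) / #|I|%:R.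
      rewrite exchange_big mulr_suml /=; apply: eq_bigr => i _.
      rewrite mulr_suml; apply: eq_bigr => t _.
      by rewrite -mulr_suml a_sum mul1r.
    have -> : \sum_c \sum_(i : I) a c / #|I|%:R * z c = \sum_c a c * z c.
      by apply: eq_bigr => c _; rewrite -mulr_suml summ.
    by rewrite -mulr_natr; field.
  rewrite -[leLHS]add0r lerD //.
    by apply: sumr_ge0 => i _; rewrite divr_ge0 //; have := fx (inl i).
  rewrite -sumrN; apply: ler_sum => c _; rewrite -sumrN; apply: ler_sum => i _.
  by rewrite -mulrN ler_wpM2l ?divr_ge0 //; have := fx (inr (c, i)).
exists (fun i => \sum_t xy x t i), (fun c i => D c i + xy x (tg c) i + xz x c),
  (xy x), (xz x), (q \o inl), (fun c i => q (inr (c, i))).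
have gE' (y : T -> I -> R) (z : Z -> R) (s : R) :
    s + \sum_c a c * z c = \sum_i q (inl i) * (s - \sum_t y t i)
      + \sum_c \sum_i q (inr (c, i)) * (y (tg c) i + z c).
  have := gE (pack y z s); rewrite /g packs.
  rewrite (eq_bigr (fun c => a c * z c)) => [->|c _]; last by rewrite packz.
  rewrite big_sumType pair_bigA /=; congr (_ + _).
    apply: eq_bigr => i _; rewrite packs; congr (_ * (_ - _)).
    by apply: eq_bigr => t _; rewrite packy.
  by apply: eq_bigr => -[c i] _; rewrite packy packz.
have qsum : \sum_i q (inl i) = 1.
  have := gE' (fun=> fun=> 0) (fun=> 0) 1; rewrite /=.
  under eq_bigr => c _ do rewrite mulr0.
  rewrite big1 // addr0 => ->.
  rewrite [X in _ = _ + X]big1 ?addr0 => [|c _]; last by rewrite big1 // => i _; rewrite mulr0.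
  by apply: eq_bigr => i _; rewrite big1 // subr0 mulr1.
have xu i : \sum_t xy x t i <= xs x by have := fx (inl i); rewrite /= subr_ge0.
have sE : \sum_i q (inl i) * (\sum_t xy x t i) = xs x.
  rewrite -[RHS]mul1r -qsum mulr_suml; apply: eq_bigr => i _; apply/esym/eqP.
  by rewrite -subr_eq0 -mulrBr; have := qE (inl i); rewrite /= subr0 => ->.
split; first split => //=.
- by move=> i; rewrite sE.
- by move=> c i; have := fx (inr (c, i)); rewrite /= lerNl -subr_ge0 opprK -addrA addrC.
- by move=> c i; have := qE (inr (c, i)); rewrite /= opprK => <-; congr (_ * _); ring.
- by move=> i; rewrite /res0 subrr.
- by move=> c i; rewrite /res; ring.
- move=> c; have := gE' (fun=> fun=> 0) (fun c' => (c' == c)%:R) 0; rewrite /=.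
  under eq_bigr => c' _ do rewrite mulrC.
  rewrite add0r sum_delta => ->.
  rewrite [X in _ = X + _]big1 ?add0r => [|i _]; last by rewrite big1 // oppr0 mulr0.
  under [RHS]eq_bigr => c' _ do
    (under eq_bigr => i _ do rewrite add0r mulrC; rewrite -mulr_sumr).
  by rewrite sum_delta.
- move=> t i; have := gE' (fun t' i' => (t' == t)%:R * (i' == i)%:R) (fun=> 0) 0; rewrite /=.
  under eq_bigr => c _ do rewrite mulr0.
  rewrite big1 // addr0.
  under eq_bigr => i' _ do rewrite sum_delta sub0r mulrN mulrC.
  rewrite sumrN sum_delta.
  under [X in _ = _ + X]eq_bigr => c _ do under eq_bigr => i' _ do rewrite addr0 mulrC.
  rewrite (sum_tg (fun t' i' => (t' == t)%:R * (i' == i)%:R)) /=.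
  under [X in _ = _ + X]eq_bigr => t' _ do
    (under eq_bigr => i' _ do rewrite -mulrA; rewrite -mulr_sumr sum_delta).
  by rewrite sum_delta addrC => /esym/eqP; rewrite subr_eq0 => /eqP.
Qed.

(** * First-order conditions of the subproblems *)

Variable beta : R.
Hypothesis beta_gt0 : 0 < beta.

(** The augmented Lagrangian without its maximum and indicator terms, as a function of [z] and of
    the residuals. All blocks enter the residuals affinely, so one expansion along a line serves
    every subproblem. *)
Definition smooth (z : Z -> R) (r0 : I -> R) (r : Z -> I -> R) (l : I -> R)
    (L : Z -> I -> R) : R :=
  \sum_c z c * a c + \sum_i (l i * r0 i + beta / 2 * r0 i ^+ 2)
  + \sum_c \sum_i (L c i * r c i + beta / 2 * r c i ^+ 2).

Lemma smooth_line (e : R) z r0 r dz d0 d l L :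
  smooth (fun c => z c + e * dz c) (fun i => r0 i + e * d0 i)
    (fun c i => r c i + e * d c i) l L
  = smooth z r0 r l L
    + e * (\sum_c dz c * a c + \sum_i (l i + beta * r0 i) * d0 i
           + \sum_c \sum_i (L c i + beta * r c i) * d c i)
    + e ^+ 2 * (beta / 2 * (\sum_i d0 i ^+ 2 + \sum_c \sum_i d c i ^+ 2)).
Proof.
rewrite /smooth.
have -> : \sum_c (z c + e * dz c) * a c = \sum_c z c * a c + e * \sum_c dz c * a c.
  by rewrite mulr_sumr -big_split; apply: eq_bigr => c _ /=; ring.
have -> : \sum_i (l i * (r0 i + e * d0 i) + beta / 2 * (r0 i + e * d0 i) ^+ 2)
    = \sum_i (l i * r0 i + beta / 2 * r0 i ^+ 2)
      + (e * \sum_i (l i + beta * r0 i) * d0 i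
         + e ^+ 2 * (beta / 2 * \sum_i d0 i ^+ 2)).
  by rewrite !mulr_sumr -!big_split; apply: eq_bigr => i _ /=; field.
have -> : \sum_c \sum_i (L c i * (r c i + e * d c i) + beta / 2 * (r c i + e * d c i) ^+ 2)
    = \sum_c \sum_i (L c i * r c i + beta / 2 * r c i ^+ 2)
      + (e * \sum_c \sum_i (L c i + beta * r c i) * d c i
         + e ^+ 2 * (beta / 2 * \sum_c \sum_i d c i ^+ 2)).
  rewrite !mulr_sumr -!big_split; apply: eq_bigr => c _ /=.
  by rewrite !mulr_sumr -!big_split; apply: eq_bigr => i _ /=; field.
ring.
Qed.

(** Only steps up to 1 are tested, because perturbations of [(u, V)] may leave the constraints for
    longer ones. *)
Lemma slope_ge0 (A B : R) : (forall e, 0 < e <= 1 -> 0 <= e * A + e ^+ 2 * B) -> 0 <= A.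
Proof.
move=> H; rewrite leNgt; apply/negP => A0.
have d0 : 0 < `|B| - A by have := normr_ge0 B; lra.
have eE : - A / (`|B| - A) * (`|B| - A) = - A by rewrite divfK // gt_eqF.
have e0 : 0 < - A / (`|B| - A) by rewrite divr_gt0 // oppr_gt0.
have e1 : - A / (`|B| - A) <= 1 by rewrite ler_pdivrMr // mul1r lerDr.
have := H (- A / (`|B| - A)); rewrite e0 e1 => /(_ isT).
(* [e] solves [e * (|B| - A) = - A], so [A + e * |B| = e * A < 0]. *)
set e := _ / _ in eE e0 e1 *.
rewrite expr2 -mulrA -mulrDr pmulr_rge0 //.
have := ler_norm B => BB.
have : e * B <= e * `|B| by rewrite ler_pM2l.
have : e * A < 0 by rewrite pmulr_rlt0.
nra.
Qed.

Lemma slope_eq0 (A B : R) : (forall e, 0 <= e * A + e ^+ 2 * B) -> A = 0.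
Proof.
move=> H; apply/eqP; rewrite eq_le; apply/andP; split.
  rewrite -oppr_ge0; apply: (@slope_ge0 _ B) => e _.
  by have := H (- e); rewrite sqrrN mulrN mulNr.
by apply: (@slope_ge0 _ B) => e _; exact: H.
Qed.

Lemma smooth_min_slope_ge0 (M dM : R) z r0 r dz d0 d l L :
  (forall e, 0 < e <= 1 -> M + smooth z r0 r l L <= M + e * dM
     + smooth (fun c => z c + e * dz c) (fun i => r0 i + e * d0 i)
         (fun c i => r c i + e * d c i) l L) ->
  0 <= dM + (\sum_c dz c * a c + \sum_i (l i + beta * r0 i) * d0 i
             + \sum_c \sum_i (L c i + beta * r c i) * d c i).
Proof.
move=> H; set A := (X in _ + X).
apply: (@slope_ge0 _ (beta / 2 * (\sum_i d0 i ^+ 2 + \sum_c \sum_i d c i ^+ 2))) => e.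
by move=> /H; rewrite (smooth_line e z r0 r dz d0 d) -/A => h; lra.
Qed.

Lemma smooth_min_slope_eq0 z r0 r dz d0 d l L :
  (forall e, smooth z r0 r l L
     <= smooth (fun c => z c + e * dz c) (fun i => r0 i + e * d0 i)
          (fun c i => r c i + e * d c i) l L) ->
  \sum_c dz c * a c + \sum_i (l i + beta * r0 i) * d0 i
    + \sum_c \sum_i (L c i + beta * r c i) * d c i = 0.
Proof.
move=> H; set A := LHS.
apply: (@slope_eq0 _ (beta / 2 * (\sum_i d0 i ^+ 2 + \sum_c \sum_i d c i ^+ 2))) => e.
by have := H e; rewrite (smooth_line e z r0 r dz d0 d) -/A => h; lra.
Qed.

Lemma z_stationary u V y z l L :
  (forall z', smooth z (res0 u y) (res V y z) l L <= smooth z' (res0 u y) (res V y z') l L) ->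
  forall c, \sum_i (L c i + beta * res V y z c i) = a c.
Proof.
move=> H c; pose dz c' : R := (c' == c)%:R.
have E e : smooth z (res0 u y) (res V y z) l L
  <= smooth (fun c' => z c' + e * dz c') (fun i => res0 u y i + e * 0)
       (fun c' i => res V y z c' i + e * - dz c') l L.
  rewrite [X in _ <= smooth _ _ X _ _](_ : _ = res V y (fun c' => z c' + e * dz c')).
    rewrite [X in _ <= smooth _ X _ _ _](_ : _ = res0 u y) //.
    by apply/funext => i; rewrite mulr0 addr0.
  by apply/funext => c'; apply/funext => i; rewrite /res; ring.
have /eqP := smooth_min_slope_eq0 E; rewrite sum_delta [X in _ + X + _]big1; last first.
  by move=> i _; rewrite mulr0.
under eq_bigr => c' _ do (rewrite -mulr_suml mulrN mulrC).
by rewrite sumrN sum_delta addr0 subr_eq0 => /eqP.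
Qed.

Lemma y_stationary u V y z l L :
  (forall y', smooth z (res0 u y) (res V y z) l L <= smooth z (res0 u y') (res V y' z) l L) ->
  forall t i, \sum_(c | tg c == t) (L c i + beta * res V y z c i)
              = l i + beta * res0 u y i.
Proof.
move=> H t i; pose dy t' i' : R := (t' == t)%:R * (i' == i)%:R.
have E e : smooth z (res0 u y) (res V y z) l L
  <= smooth (fun c => z c + e * 0) (fun i' => res0 u y i' + e * (i' == i)%:R)
       (fun c i' => res V y z c i' + e * - dy (tg c) i') l L.
  rewrite [X in _ <= smooth X _ _ _ _](_ : _ = z); last first.
    by apply/funext => c; rewrite mulr0 addr0.
  rewrite [X in _ <= smooth _ _ X _ _](_ : _ = res V (fun t' i' => y t' i' + e * dy t' i') z).
    rewrite [X in _ <= smooth _ X _ _ _](_ : _ = res0 u (fun t' i' => y t' i' + e * dy t' i')) //.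
    by apply/funext => i'; rewrite /res0 big_split /= -mulr_sumr /dy sum_delta; ring.
  by apply/funext => c'; apply/funext => i'; rewrite /res; ring.
have := smooth_min_slope_eq0 E; rewrite big1 ?add0r => [|c _]; last by rewrite mul0r.
under eq_bigr => i' _ do rewrite mulrC.
rewrite sum_delta.
under eq_bigr => c _ do under eq_bigr => i' _ do rewrite mulrN -mulNr mulrC.
rewrite (sum_tg dy (fun c i => - (L c i + beta * res V y z c i))).
under [X in _ + X]eq_bigr => t' _ do
  (under eq_bigr => i' _ do rewrite -mulrA; rewrite -mulr_sumr sum_delta).
by rewrite sum_delta sumrN => /eqP; rewrite subr_eq0 => /eqP.
Qed.

(* Allowing any upper bound [M'] of [u'] in place of its maximum spares the maximum
   of the perturbed point. *)
Lemma uV_stationary u V y z l L (M : R) :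
  (forall i, u i <= M) -> (forall c i, 0 <= V c i) ->
  (forall u' V' M', (forall i, u' i <= M') -> (forall c i, 0 <= V' c i) ->
     M + smooth z (res0 u y) (res V y z) l L
     <= M' + smooth z (res0 u' y) (res V' y z) l L) ->
  subgrad u V (fun i => l i + beta * res0 u y i) (fun c i => L c i + beta * res V y z c i).
Proof.
move=> uM V0 H; set l' := fun i => _; set L' := fun c i => _.
(* The first-order condition along [(du, dV)], with [dM] bounding the growth rate of the maximum.
   Each multiplier condition below comes from one or two choices of direction. *)
have key du dV dM :
    (forall e, 0 < e <= 1 -> forall i, u i + e * du i <= M + e * dM) ->
    (forall e, 0 < e <= 1 -> forall c i, 0 <= V c i + e * dV c i) ->
    0 <= dM - \sum_i l' i * du i + \sum_c \sum_i L' c i * dV c i.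
  move=> Hu HV.
  have E e : 0 < e <= 1 -> M + smooth z (res0 u y) (res V y z) l L <= M + e * dM
      + smooth (fun c => z c + e * 0) (fun i => res0 u y i + e * - du i)
         (fun c i => res V y z c i + e * dV c i) l L.
    move=> e01.
    rewrite [X in _ <= _ + smooth X _ _ _ _](_ : _ = z); last first.
      by apply/funext => c; rewrite mulr0 addr0.
    rewrite [X in _ <= _ + smooth _ X _ _ _](_ : _ = res0 (fun i => u i + e * du i) y); last first.
      by apply/funext => i; rewrite /res0; ring.
    rewrite [X in _ <= _ + smooth _ _ X _ _](_ : _ = res (fun c i => V c i + e * dV c i) y z).
      by apply: H => [i|c i]; [exact: Hu | exact: HV].
    by apply/funext => c; apply/funext => i; rewrite /res; ring.
  have := smooth_min_slope_ge0 E; rewrite [X in _ + (X + _ + _)]big1 ?add0r => [|c _].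
    by under eq_bigr => i _ do rewrite mulrN; rewrite sumrN addrA.
  by rewrite mul0r.
have sum0 (F : Z -> I -> R) : \sum_c \sum_i F c i * 0 = 0.
  by rewrite big1 // => c _; rewrite big1 // => i _; rewrite mulr0.
have sum0' (F : I -> R) : \sum_i F i * 0 = 0.
  by rewrite big1 // => i _; rewrite mulr0.
have V0' (e : R) c i : 0 <= V c i + e * 0 by rewrite mulr0 addr0.
have sumF (F : Z -> I -> R) c i x :
    \sum_c' \sum_i' F c' i' * ((c' == c)%:R * ((i' == i)%:R * x)) = F c i * x.
  under eq_bigr => c' _ do
    (under eq_bigr => i' _ do rewrite mulrC -!mulrA; rewrite -mulr_sumr sum_delta).
  by rewrite sum_delta mulrC.
have L0 c i : 0 <= L' c i.
  have := @key (fun=> 0) (fun c' i' => (c' == c)%:R * ((i' == i)%:R * 1)) 0.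
  rewrite sum0' subr0 add0r sumF mulr1; apply=> [e _ i'|e /andP[/ltW e0 _] c' i'].
    by rewrite !mulr0 !addr0.
  by rewrite addr_ge0 // !mulr_ge0.
have h1 := @key (fun=> 1) (fun _ _ => 0) 1.
have h2 := @key (fun=> - 1) (fun _ _ => 0) (- 1).
split=> //.
- move=> i; have := @key (fun i' => - (i' == i)%:R) (fun _ _ => 0) 0.
  rewrite sum0 addr0 sub0r -sumrN; under eq_bigr => i' _ do rewrite mulrN opprK mulrC.
  rewrite sum_delta; apply=> // e e01 i'; rewrite mulr0 addr0 mulrN.
  by apply: le_trans (uM i'); rewrite gerBl mulr_ge0 // ltW //; case/andP: e01.
- move: h1 h2; rewrite !sum0 !addr0 -!mulr_suml mulr1 mulrN1 opprK => h1 h2.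
  apply/eqP; rewrite eq_le -subr_ge0 -[X in _ && X]subr_ge0.
  rewrite h1 //= => [|e _ i]; last by rewrite lerD2r.
  by rewrite addrC h2 // => e _ i; rewrite lerD2r.
(* Shrinking [u] and [M] together by the factor [1 - e] keeps [M] an upper bound and yields
   [M <= sum_j l' j * u j]. *)
- move=> i; apply: le_trans (uM i) _.
  have := @key (fun i => - u i) (fun _ _ => 0) (- M).
  rewrite sum0 addr0 -sumrN; under eq_bigr => i' _ do rewrite mulrN opprK.
  rewrite addrC subr_ge0; apply=> // e /andP[e0 e1] i'.
  by have := uM i'; nra.
- move=> c i; apply/eqP; rewrite eq_le mulr_ge0 // andbT -oppr_ge0.
  have := @key (fun=> 0) (fun c' i' => (c' == c)%:R * ((i' == i)%:R * - V c i)) 0.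
  rewrite sum0' subr0 add0r sumF mulrN; apply=> [e _ i'|e /andP[/ltW e0 e1] c' i'].
    by rewrite !mulr0 !addr0.
  have [->|_] := eqVneq c' c; last by rewrite mul0r.
  have [->|_] := eqVneq i' i; last by rewrite mul0r mulr0.
  by rewrite !mul1r mulrN -{1}[V c i]mul1r -mulrBl mulr_ge0 // subr_ge0.
Qed.

(** The last update of [z] lowers each of its entries in plan [t] by the mean increase of the
    entries of [y t]. A row sum of plan [t] collects this once per column, times [beta]; hence the
    number of columns over the number of rows. *)
Definition prox_weight (t : T) : R := beta * #|[pred c | tg c == t]|%:R / #|I|%:R.

Lemma prox_weight_ge0 t : 0 <= prox_weight t.
Proof. by rewrite divr_ge0 // mulr_ge0 // ltW. Qed.

(* The backward sweep over [z] before the [y]-update turns the sweep z, y, z into a joint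
   minimisation in [(y, z)] with the extra proximal term
   [1/2 sum_t prox_weight t * (sum_i (y' t i - y t i)) ^ 2]. *)
Lemma sweep_stationary u V y zt y' z' l L :
  (forall z, smooth zt (res0 u y) (res V y zt) l L <= smooth z (res0 u y) (res V y z) l L) ->
  (forall x, smooth zt (res0 u y') (res V y' zt) l L
             <= smooth zt (res0 u x) (res V x zt) l L) ->
  (forall z, smooth z' (res0 u y') (res V y' z') l L
             <= smooth z (res0 u y') (res V y' z) l L) ->
  (forall c, \sum_i (L c i + beta * res V y' z' c i) = a c) /\
  (forall t i, \sum_(c | tg c == t) (L c i + beta * res V y' z' c i)
     = l i + beta * res0 u y' i
       + prox_weight t * (\sum_i y' t i - \sum_i y t i)).
Proof.
move=> /z_stationary Hzt /y_stationary Hy /z_stationary Hz; split=> // t i.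
have mN0 : #|I|%:R != 0 :> R by rewrite pnatr_eq0 -lt0n.
have dz c : zt c - z' c = (\sum_i y' (tg c) i - \sum_i y (tg c) i) / #|I|%:R.
  apply: (mulIf mN0); rewrite divfK //.
  have : \sum_i (L c i + beta * res V y zt c i) = \sum_i (L c i + beta * res V y' z' c i).
    by rewrite Hzt Hz.
  rewrite !big_split /= -!mulr_sumr => /addrI /(mulfI (lt0r_neq0 beta_gt0)).
  rewrite /res !sumrB !sumr_const -[z' c *+ _]mulr_natr -[zt c *+ _]mulr_natr; lra.
have -> : \sum_(c | tg c == t) (L c i + beta * res V y' z' c i)
   = \sum_(c | tg c == t) (L c i + beta * res V y' zt c i)
     + \sum_(c | tg c == t) beta * ((\sum_i y' t i - \sum_i y t i) / #|I|%:R).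
  rewrite -big_split /=; apply: eq_bigr => c /eqP ct; rewrite -ct -dz /res; ring.
by rewrite Hy sumr_const /prox_weight -[_ *+ _]mulr_natr; congr (_ + _); field.
Qed.

(** [l] maximises the pairing with [u] over the simplex and [l'] the pairing with [u']; in the
    matrix block, complementarity leaves only cross products of nonnegative entries. *)
Lemma subgrad_monotone u V l L u' V' l' L' :
  subgrad u V l L -> subgrad u' V' l' L' ->
  \sum_i (u' i - u i) * (l i - l' i)
  + \sum_c \sum_i (V c i - V' c i) * (L c i - L' c i) <= 0.
Proof.
move=> [l0 l1 ul V0 L0 LV] [l'0 l'1 ul' V'0 L'0 LV'].
have HV : \sum_c \sum_i (V c i - V' c i) * (L c i - L' c i) <= 0.
  apply: sumr_le0 => c _; apply: sumr_le0 => i _.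
  have := mulr_ge0 (L0 c i) (V'0 c i); have := mulr_ge0 (L'0 c i) (V0 c i).
  by have := LV c i; have := LV' c i; lra.
have cross (p q v : I -> R) : (forall i, 0 <= p i) -> \sum_i p i = 1 ->
    (forall i, v i <= \sum_j q j * v j) -> \sum_i p i * v i <= \sum_i q i * v i.
  move=> p0 p1 pv; rewrite -[leRHS]mul1r -p1 mulr_suml.
  by apply: ler_sum => i _; rewrite ler_wpM2l.
have -> : \sum_i (u' i - u i) * (l i - l' i)
    = \sum_i l i * u' i - \sum_i l' i * u' i - \sum_i l i * u i + \sum_i l' i * u i.
  by rewrite -!sumrB -big_split; apply: eq_bigr => i _ /=; ring.
by have := cross _ _ _ l0 l1 ul'; have := cross _ _ _ l'0 l'1 ul; lra.
Qed.

Definition stack (f : I -> R) (F : Z -> I -> R) (k : I + Z * I) : R :=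
  match k with inl i => f i | inr p => F p.1 p.2 end.

Lemma sum_stack f F f' F' :
  \sum_k stack f F k * stack f' F' k
  = \sum_i f i * f' i + \sum_c \sum_i F c i * F' c i.
Proof. by rewrite big_sumType /= pair_bigA. Qed.

(** The linear part in [(y, z)] of the stacked residual. *)
Definition yz_map (y : T -> I -> R) (z : Z -> R) : I + Z * I -> R :=
  stack (fun i => \sum_t y t i) (fun c i => - y (tg c) i - z c).

(** Taking row and column sums is, up to sign, the adjoint of [yz_map]. The term [b] is zero for a
    KKT point and the proximal correction for an iterate. *)
Lemma yz_map_adjoint y z p P (b : T -> R) :
  (forall c, \sum_i P c i = a c) ->
  (forall t i, \sum_(c | tg c == t) P c i = p i + b t) ->
  \sum_k yz_map y z k * stack p P k + \sum_t b t * (\sum_i y t i)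
  + \sum_c z c * a c = 0.
Proof.
move=> col row; rewrite sum_stack.
have -> : \sum_c \sum_i (- y (tg c) i - z c) * P c i
    = - \sum_c \sum_i y (tg c) i * P c i - \sum_c z c * a c.
  rewrite -sumrN -sumrB; apply: eq_bigr => c _.
  rewrite -col mulr_sumr -sumrN -sumrB; apply: eq_bigr => i _; ring.
rewrite sum_tg.
have -> : \sum_t \sum_i y t i * (\sum_(c | tg c == t) P c i)
   = \sum_i (\sum_t y t i) * p i + \sum_t b t * (\sum_i y t i).
  have -> : \sum_i (\sum_t y t i) * p i = \sum_t \sum_i y t i * p i.
    by rewrite exchange_big; apply: eq_bigr => i _; rewrite mulr_suml.
  rewrite -big_split /=; apply: eq_bigr => t _; rewrite mulr_sumr -big_split; apply: eq_bigr => i _ /=.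
  by rewrite row; ring.
ring.
Qed.

(** * Limits of real sequences along a filter *)

Lemma ultra_bounded_cvg (U : set_system nat) (x : nat -> R) (M : R) :
  UltraFilter U -> (forall n, `|x n| <= M) -> exists b : R, x n @[n --> U] --> b.
Proof.
move=> UU xM.
have memU : (x n @[n --> U]) `[- M, M]%classic.
  by apply: (@filterS _ U _ setT) => [n _ /=|]; [rewrite in_itv /= -ler_norml | exact: filterT].
have [p [_ cp]] := @segment_compact R (- M) M _ _ memU.
exists p => B nB; have [//|nU] := in_ultra_setVsetC (x @^-1` B) UU.
by have [v [/= nv Bv]] := cp (~` B) B nU nB.
Qed.

Lemma sqr_cvg0 (F : set_system nat) (x e : nat -> R) (C : R) :
  Filter F -> 0 < C -> (forall n, C * x n ^+ 2 <= e n) ->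
  e n @[n --> F] --> (0 : R) -> x n @[n --> F] --> (0 : R).
Proof.
move=> FF C0 xe /cvgr0Pnorm_lt e0; apply/cvgr0Pnorm_lt => d d0.
have := e0 (C * d ^+ 2); rewrite mulr_gt0 ?exprn_gt0 // => /(_ isT).
apply: filterS => n en; rewrite -ltr_sqr ?nnegrE ?normr_ge0 ?(ltW d0) //.
rewrite real_normK ?num_real // -(ltr_pM2l C0).
exact: le_lt_trans (xe n) (le_lt_trans (ler_norm _) en).
Qed.

Lemma cvg_sumr (J : Type) (s : seq J) (P : pred J) (F : set_system nat) (x : nat -> J -> R)
    (b : J -> R) : Filter F ->
  (forall j, x n j @[n --> F] --> b j) ->
  \sum_(j <- s | P j) x n j @[n --> F] --> \sum_(j <- s | P j) b j.
Proof.
move=> FF xb; apply: cvg_big => [|j _]; last exact: xb.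
exact: add_continuous.
Qed.

(** * Descent and convergence of the iterates *)

Section Iteration.
Variables (tau : R) (u : nat -> I -> R) (V : nat -> Z -> I -> R) (y : nat -> T -> I -> R)
  (z : nat -> Z -> R) (l : nat -> I -> R) (L : nat -> Z -> I -> R).
Hypothesis uV_step : forall k, subgrad (u k.+1) (V k.+1)
  (fun i => l k i + beta * res0 (u k.+1) (y k) i)
  (fun c i => L k c i + beta * res (V k.+1) (y k) (z k) c i).
Hypothesis col_step : forall k c,
  \sum_i (L k c i + beta * res (V k.+1) (y k.+1) (z k.+1) c i) = a c.
Hypothesis row_step : forall k t i,
  \sum_(c | tg c == t) (L k c i + beta * res (V k.+1) (y k.+1) (z k.+1) c i)
  = l k i + beta * res0 (u k.+1) (y k.+1) i
    + prox_weight t * (\sum_i y k.+1 t i - \sum_i y k t i).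
Hypothesis l_step : forall k i, l k.+1 i = l k i + tau * beta * res0 (u k.+1) (y k.+1) i.
Hypothesis L_step : forall k c i,
  L k.+1 c i = L k c i + tau * beta * res (V k.+1) (y k.+1) (z k.+1) c i.
Hypothesis (tau_gt0 : 0 < tau).

Definition resid_at k : I + Z * I -> R :=
  stack (res0 (u k) (y k)) (res (V k) (y k) (z k)).

Definition mult_err ls Ls k : I + Z * I -> R :=
  stack (fun i => l k i - ls i) (fun c i => L k c i - Ls c i).

Definition yz_err ys zs k : I + Z * I -> R :=
  yz_map (fun t i => y k t i - ys t i) (fun c => z k c - zs c).

Definition row_err (ys : T -> I -> R) k t : R := \sum_i (y k t i - ys t i).

Definition merit th ys zs ls Ls k : R :=
  lyap prox_weight beta tau th (mult_err ls Ls k) (resid_at k) (yz_err ys zs k)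
    (row_err ys k) (row_err ys k.-1).

Lemma row_errB ys k j t :
  row_err ys k t - row_err ys j t = \sum_i y k t i - \sum_i y j t i.
Proof. by rewrite /row_err -!sumrB; apply: eq_bigr => i _; ring. Qed.

Lemma yz_errB ys zs k j x : yz_err ys zs k x - yz_err ys zs j x
  = yz_map (fun t i => y k t i - y j t i) (fun c => z k c - z j c) x.
Proof. by case: x => [i|[c i]]; rewrite /yz_err /yz_map /= ?sumrB; ring. Qed.

Section Reference.
Variables (us : I -> R) (Vs : Z -> I -> R) (ys : T -> I -> R) (zs : Z -> R)
  (ls : I -> R) (Ls : Z -> I -> R).
Hypothesis ref : kkt us Vs ys zs ls Ls.

(** Stationarity of the sweep minus that of the reference point, which cancels [a]. The direction is
    free: it is taken once as the error and once as the increment of [(y, z)]. *)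
Lemma mult_orth dy dz k :
  \sum_x yz_map dy dz x * (mult_err ls Ls k x + beta * resid_at k.+1 x)
  + \sum_t prox_weight t * ((row_err ys k.+1 t - row_err ys k t) * \sum_i dy t i) = 0.
Proof.
have /= A1 := yz_map_adjoint dy dz (col_step k) (row_step k).
have A2 := yz_map_adjoint dy dz (p := ls) (b := fun=> 0) (kkt_col ref)
  (fun t i => etrans (kkt_row ref t i) (esym (addr0 _))).
have B : \sum_t 0 * \sum_i dy t i = 0 by rewrite big1 // => t _; rewrite mul0r.
rewrite B addr0 in A2.
under eq_bigr => x _.
  have -> : mult_err ls Ls k x + beta * resid_at k.+1 x
     = stack (fun i => l k i + beta * res0 (u k.+1) (y k.+1) i)
         (fun c i => L k c i + beta * res (V k.+1) (y k.+1) (z k.+1) c i) x - stack ls Ls x.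
    by case: x => [i|[c i]]; rewrite /mult_err /resid_at /=; ring.
  rewrite mulrBr; over.
rewrite sumrB; under [X in _ + X]eq_bigr => t _ do rewrite row_errB mulrA.
by lra.
Qed.

(** Descent starts at index 1, since it compares the stationarity of two consecutive sweeps and the
    merit at [k] looks back to [k.-1]. *)
Lemma merit_descent th k : 0 < th ->
  merit th ys zs ls Ls k.+2
  + (\sum_x beta * ((2 - tau - `|1 - tau| * th) * resid_at k.+2 x ^+ 2
               + (1 - `|1 - tau| / th) * (yz_err ys zs k.+2 x - yz_err ys zs k.+1 x) ^+ 2)
     + \sum_t prox_weight t * (row_err ys k.+2 t - row_err ys k.+1 t) ^+ 2)
  <= merit th ys zs ls Ls k.+1.
Proof.
move=> th0; apply: lyap_descent => //; first exact: prox_weight_ge0.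
- have := subgrad_monotone (uV_step k.+1) ref; rewrite -sum_stack.
  congr (_ <= 0); apply: eq_bigr => -[i|[c i]] _; rewrite /resid_at /yz_err /mult_err /yz_map /=.
    have := kkt_res0 ref i; rewrite /res0 !sumrB => r0; congr (_ * _); last by ring.
    have -> : us i = \sum_t ys t i by lra.
    ring.
  have := kkt_res ref c i; rewrite /res => r0; congr (_ * _); last by ring.
  have -> : Vs c i = D c i + ys (tg c) i + zs c by lra.
  ring.
- rewrite -[RHS](mult_orth (fun t i => y k.+2 t i - ys t i) (fun c => z k.+2 c - zs c) k.+1).
  congr (_ + _); apply: eq_bigr => t _; congr (_ * _); exact: mulrC.
(* Orthogonality at [k.+1] minus orthogonality at [k], both in the direction of the last increment.
   The multiplier update, of length [tau * beta], produces the factor [1 - tau] in front of the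
   older residual. *)
- pose dy t i := y k.+2 t i - y k.+1 t i; pose dz c := z k.+2 c - z k.+1 c.
  have := mult_orth dy dz k.+1; have := mult_orth dy dz k.
  rewrite [in X in _ -> _ -> X](eq_bigr (fun x =>
      yz_map dy dz x * (mult_err ls Ls k.+1 x + beta * resid_at k.+2 x)
      - yz_map dy dz x * (mult_err ls Ls k x + beta * resid_at k.+1 x))) => [|x _].
    rewrite [X in _ -> _ -> _ + X = _](eq_bigr (fun t =>
      prox_weight t * ((row_err ys k.+2 t - row_err ys k.+1 t) * \sum_i dy t i)
      - prox_weight t * ((row_err ys k.+1 t - row_err ys k t) * \sum_i dy t i))) => [|t _].
      by rewrite !sumrB => *; lra.
    have -> : \sum_i dy t i = row_err ys k.+2 t - row_err ys k.+1 t by rewrite row_errB sumrB.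
    ring.
  rewrite yz_errB -mulrBr [LHS]mulrC; congr (_ * _).
  have -> : mult_err ls Ls k.+1 x = mult_err ls Ls k x + tau * beta * resid_at k.+1 x.
    by case: x => [i|[c i]]; rewrite /mult_err /resid_at /= ?l_step ?L_step; ring.
  ring.
- by case=> [i|[c i]]; rewrite /mult_err /resid_at /= ?l_step ?L_step; ring.
Qed.

Variable th : R.
Hypotheses (th_gt0 : 0 < th) (margin_r : 0 < 2 - tau - `|1 - tau| * th)
  (margin_g : 0 < 1 - `|1 - tau| / th).
(* [rep t] is a column of the [t]-th plan, so none of the plans is empty. *)
Variable rep : T -> Z.
Hypothesis repK : forall t, tg (rep t) = t.

Let phi := merit th ys zs ls Ls.

Lemma prox_weight_gt0 t : 0 < prox_weight t.
Proof.
rewrite divr_gt0 ?ltr0n // mulr_gt0 // ltr0n.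
by apply/card_gt0P; exists (rep t); rewrite inE repK.
Qed.

Lemma merit_ge k : [/\ 0 <= phi k, forall x, (tau * beta)^-1 * mult_err ls Ls k x ^+ 2 <= phi k,
  forall x, beta * yz_err ys zs k x ^+ 2 <= phi k
  & forall t, prox_weight t * row_err ys k t ^+ 2 <= phi k].
Proof. exact: (lyap_ge _ _ _ _ _ beta_gt0 tau_gt0 th_gt0 prox_weight_ge0). Qed.

Lemma merit_drop k :
  [/\ phi k.+2 <= phi k.+1,
      forall x, beta * (2 - tau - `|1 - tau| * th) * resid_at k.+2 x ^+ 2
                <= phi k.+1 - phi k.+2,
      forall x, beta * (1 - `|1 - tau| / th)
                * (yz_err ys zs k.+2 x - yz_err ys zs k.+1 x) ^+ 2 <= phi k.+1 - phi k.+2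
    & forall t, prox_weight t * (row_err ys k.+2 t - row_err ys k.+1 t) ^+ 2
                <= phi k.+1 - phi k.+2].
Proof.
have := merit_descent k th_gt0; rewrite -/(phi _) -/(phi _).
set A := \sum_x _; set B := \sum_t _ => drop.
have p1 x : 0 <= beta * (2 - tau - `|1 - tau| * th) * resid_at k.+2 x ^+ 2.
  by rewrite mulr_ge0 ?sqr_ge0 // mulr_ge0 ?ltW.
have p2 x : 0 <= beta * (1 - `|1 - tau| / th)
    * (yz_err ys zs k.+2 x - yz_err ys zs k.+1 x) ^+ 2.
  by rewrite mulr_ge0 ?sqr_ge0 // mulr_ge0 ?ltW.
have p3 t : 0 <= prox_weight t * (row_err ys k.+2 t - row_err ys k.+1 t) ^+ 2.
  by rewrite mulr_ge0 ?sqr_ge0 ?prox_weight_ge0.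
have A0 x : 0 <= beta * ((2 - tau - `|1 - tau| * th) * resid_at k.+2 x ^+ 2
    + (1 - `|1 - tau| / th) * (yz_err ys zs k.+2 x - yz_err ys zs k.+1 x) ^+ 2).
  by have h1 := p1 x; have h2 := p2 x; lra.
have leA x := le_sum_term x A0; have leB t := le_sum_term t p3.
rewrite -/A in leA; rewrite -/B in leB.
have SA : 0 <= A by apply: sumr_ge0.
have SB : 0 <= B by apply: sumr_ge0.
split=> [|x|x|t]; first by lra.
- by have h1 := leA x; have h2 := p2 x; lra.
- by have h1 := leA x; have h2 := p1 x; lra.
- by have h1 := leB t; lra.
Qed.

Lemma merit_noninc m n : (m <= n)%N -> phi n.+1 <= phi m.+1.
Proof.
move=> /subnK <-; elim: (n - m)%N => [|d IH] //.
by apply: le_trans IH; rewrite addSn; have [] := merit_drop (d + m).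
Qed.

Lemma merit_drop_cvg0 : (phi n.+1 - phi n.+2) @[n --> \oo] --> (0 : R).
Proof.
have c : cvgn (fun n => phi n.+1).
  apply: nonincreasing_is_cvgn; first by move=> m n; exact: merit_noninc.
  by exists 0 => _ [n _ <-]; have [] := merit_ge n.+1.
rewrite -(subrr (limn (fun n => phi n.+1))); apply: cvgB => //.
by rewrite (cvg_shiftS (fun n => phi n.+1)).
Qed.

Lemma resid_cvg0 x : resid_at n x @[n --> \oo] --> (0 : R).
Proof.
rewrite -cvg_shiftS -cvg_shiftS.
apply: sqr_cvg0 merit_drop_cvg0; first exact: (mulr_gt0 beta_gt0 margin_r).
by move=> n; have [_ /(_ x)] := merit_drop n.
Qed.

Lemma yz_step_cvg0 x :
  yz_map (fun t i => y n.+1 t i - y n t i) (fun c => z n.+1 c - z n c) x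
    @[n --> \oo] --> (0 : R).
Proof.
rewrite -cvg_shiftS; apply: sqr_cvg0 merit_drop_cvg0.
  exact: (mulr_gt0 beta_gt0 margin_g).
by move=> n; have [_ _ /(_ x)] := merit_drop n; rewrite yz_errB.
Qed.

Lemma row_step_cvg0 t :
  (\sum_i y n.+1 t i - \sum_i y n t i) @[n --> \oo] --> (0 : R).
Proof.
rewrite -cvg_shiftS; apply: sqr_cvg0 merit_drop_cvg0; first exact: (prox_weight_gt0 t).
by move=> n; have [_ _ _ /(_ t)] := merit_drop n; rewrite row_errB.
Qed.

Lemma sqr_bound (C x e : R) : 0 < C -> C * x ^+ 2 <= e -> `|x| <= e / C + 1.
Proof.
move=> C0; rewrite mulrC -ler_pdivlMr // => xe.
have := sqr_ge0 (`|x| - 1); rewrite sqrrB1 real_normK ?num_real //.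
have := normr_ge0 x; have := sqr_ge0 x; lra.
Qed.

Lemma err_bounded n :
  [/\ forall x, `|mult_err ls Ls n.+1 x| <= phi 1 / (tau * beta)^-1 + 1,
      forall x, `|yz_err ys zs n.+1 x| <= phi 1 / beta + 1
    & forall t, `|row_err ys n.+1 t| <= phi 1 / prox_weight t + 1].
Proof.
have [_ lb gb sb] := merit_ge n.+1; have le1 := merit_noninc (leq0n n).
split=> x; apply: sqr_bound.
- by rewrite invr_gt0 mulr_gt0.
- exact: le_trans (lb x) le1.
- exact: beta_gt0.
- exact: le_trans (gb x) le1.
- exact: prox_weight_gt0.
- exact: le_trans (sb x) le1.
Qed.

(** The entries of [yz_map y z] in column [c] add up to [- sum_i y (tg c) i] minus [#|I|] times
    [z c]; the argument [si] supplies the sum over [y]. *)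
Definition z_of (ga : I + Z * I -> R) (si : T -> R) (c : Z) : R :=
  - (\sum_i ga (inr (c, i)) + si (tg c)) / #|I|%:R.

Definition y_of (ga : I + Z * I -> R) (si : T -> R) (t : T) (i : I) : R :=
  - ga (inr (rep t, i)) - z_of ga si (rep t).

(* The proximal term makes [(y, z)] recoverable from the constraint map, whose kernel
   consists of the shifts of [y t] and [z] by opposite constants. *)
Lemma yz_map_inv (dy : T -> I -> R) (dz : Z -> R) :
  (forall c, dz c = z_of (yz_map dy dz) (fun t => \sum_i dy t i) c) /\
  (forall t i, dy t i = y_of (yz_map dy dz) (fun t => \sum_i dy t i) t i).
Proof.
have mN0 : #|I|%:R != 0 :> R by rewrite pnatr_eq0 -lt0n.
have dzE c : dz c = z_of (yz_map dy dz) (fun t => \sum_i dy t i) c.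
  rewrite /z_of /yz_map /= sumrB sumrN sumr_const -[dz c *+ _]mulr_natr.
  by field.
split=> // t i; rewrite /y_of -dzE /yz_map /= repK; ring.
Qed.

Lemma yz_of_cvg (F : set_system nat) (ga : nat -> I + Z * I -> R) (si : nat -> T -> R) ga' si' :
  Filter F -> (forall x, ga n x @[n --> F] --> ga' x) ->
  (forall t, si n t @[n --> F] --> si' t) ->
  (forall c, z_of (ga n) (si n) c @[n --> F] --> z_of ga' si' c) /\
  (forall t i, y_of (ga n) (si n) t i @[n --> F] --> y_of ga' si' t i).
Proof.
move=> FF hg hs.
have hz c : z_of (ga n) (si n) c @[n --> F] --> z_of ga' si' c.
  apply: cvgM; last exact: cvg_cst.
  apply: cvgN; apply: cvgD; last exact: hs.
  by apply: cvg_sumr => i; exact: hg.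
split=> // t i; apply: cvgB; last exact: hz.
by apply: cvgN; exact: hg.
Qed.

Lemma step_cvg0 :
  (forall t i, (y n.+1 t i - y n t i) @[n --> \oo] --> (0 : R)) /\
  (forall c, (z n.+1 c - z n c) @[n --> \oo] --> (0 : R)).
Proof.
have z0 c : z_of (fun=> 0) (fun=> 0) c = 0.
  by rewrite /z_of big1 // addr0 oppr0 mul0r.
have y0 t i : y_of (fun=> 0) (fun=> 0) t i = 0 by rewrite /y_of z0 subr0 oppr0.
have [cz cy] := yz_of_cvg _ yz_step_cvg0 row_step_cvg0.
have inv n := yz_map_inv (fun t i => y n.+1 t i - y n t i) (fun c => z n.+1 c - z n c).
split=> [t i|c].
  have := cy t i; rewrite y0; apply: cvg_trans; apply: near_eq_cvg; near=> n.
  by have [_ ->] := inv n; rewrite /=; congr y_of; apply/funext => t'; rewrite sumrB.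
have := cz c; rewrite z0; apply: cvg_trans; apply: near_eq_cvg; near=> n.
by have [-> _] := inv n; rewrite /=; congr z_of; apply/funext => t'; rewrite sumrB.
Unshelve. all: by end_near. Qed.

(** * Cluster points of the iterates *)

Lemma cvg_along (F G : set_system nat) (x : nat -> R) (b : R) :
  F `<=` G -> x n @[n --> F] --> b -> x n @[n --> G] --> b.
Proof. by move=> FG xb A /xb /FG. Qed.

Lemma cvg_ge0 (F : set_system nat) (x : nat -> R) (b : R) :
  ProperFilter F -> x n @[n --> F] --> b -> (forall n, 0 <= x n) -> 0 <= b.
Proof. by move=> FF xb x0; apply: (cvgr_to_ge xb); apply: nearW. Qed.

Lemma cvg_eq_cst (F : set_system nat) (x : nat -> R) (b c : R) :
  ProperFilter F -> x n @[n --> F] --> b -> (forall n, x n = c) -> b = c.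
Proof.
move=> FF xb xc; apply: (cvg_unique _ xb); first exact: Rhausdorff.
by rewrite (_ : x = cst c); [exact: cvg_cst | exact/funext].
Qed.

Lemma subgrad_closed (F : set_system nat) un Vn ln Ln u' V' l' L' :
  ProperFilter F -> (forall n, subgrad (un n) (Vn n) (ln n) (Ln n)) ->
  (forall i, un n i @[n --> F] --> u' i) -> (forall c i, Vn n c i @[n --> F] --> V' c i) ->
  (forall i, ln n i @[n --> F] --> l' i) -> (forall c i, Ln n c i @[n --> F] --> L' c i) ->
  subgrad u' V' l' L'.
Proof.
move=> FF sub cu cV cl cL; split=> [i||i|c i|c i|c i].
- by apply: cvg_ge0 (cl i) _ => n; have [] := sub n.
- apply: (@cvg_eq_cst F (fun n => \sum_i ln n i)) => [|n]; last by have [] := sub n.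
  by apply: cvg_sumr => i; exact: cl.
- rewrite -subr_ge0; apply: (@cvg_ge0 F (fun n => \sum_j ln n j * un n j - un n i)).
    by apply: cvgB (cu i); apply: cvg_sumr => j; exact: cvgM.
  by move=> n; rewrite subr_ge0; have [] := sub n.
- by apply: cvg_ge0 (cV c i) _ => n; have [] := sub n.
- by apply: cvg_ge0 (cL c i) _ => n; have [] := sub n.
- apply: (@cvg_eq_cst F (fun n => Ln n c i * Vn n c i)) => [|n]; last by have [] := sub n.
  exact: cvgM (cL c i) (cV c i).
Qed.

(** The merit bounds the multipliers, the image of [(y, z)] and the sums of [y], which therefore
    converge along [U], and [(y, z)] is recovered from the last two. The limits of [u] and [V] are
    dictated by the constraints, as the residuals vanish. *)
Lemma cluster_kkt (U : set_system nat) : UltraFilter U -> \oo `<=` U ->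
  exists us' Vs' ys' zs' ls' Ls', [/\ kkt us' Vs' ys' zs' ls' Ls',
    forall x, mult_err ls' Ls' n.+1 x @[n --> U] --> (0 : R),
    forall t i, y n.+1 t i @[n --> U] --> ys' t i
    & forall c, z n.+1 c @[n --> U] --> zs' c].
Proof.
move=> UU ooU.
have /boolp.choice[m mE] : forall x, exists b : R, mult_err ls Ls n.+1 x @[n --> U] --> b.
  by move=> x; apply: ultra_bounded_cvg => n; have [] := err_bounded n.
have /boolp.choice[ga gaE] : forall x, exists b : R, yz_err ys zs n.+1 x @[n --> U] --> b.
  by move=> x; apply: ultra_bounded_cvg => n; have [] := err_bounded n.
have /boolp.choice[si siE] : forall t, exists b : R, row_err ys n.+1 t @[n --> U] --> b.
  by move=> x; apply: ultra_bounded_cvg => n; have [] := err_bounded n.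
pose ls' i := m (inl i) + ls i; pose Ls' c i := m (inr (c, i)) + Ls c i.
pose ys' t i := y_of ga si t i + ys t i; pose zs' c := z_of ga si c + zs c.
have [cz cy] := yz_of_cvg _ gaE siE.
have inv n := yz_map_inv (fun t i => y n.+1 t i - ys t i) (fun c => z n.+1 c - zs c).
have cl i : l n.+1 i @[n --> U] --> ls' i.
  rewrite (_ : (fun n => _) = fun n => mult_err ls Ls n.+1 (inl i) + ls i).
    by apply: cvgD; [exact: mE | exact: cvg_cst].
  by apply/funext => n; rewrite /mult_err /= subrK.
have cL c i : L n.+1 c i @[n --> U] --> Ls' c i.
  rewrite (_ : (fun n => _) = fun n => mult_err ls Ls n.+1 (inr (c, i)) + Ls c i).
    by apply: cvgD; [exact: mE | exact: cvg_cst].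
  by apply/funext => n; rewrite /mult_err /= subrK.
have cy1 t i : y n.+1 t i @[n --> U] --> ys' t i.
  rewrite (_ : (fun n => _) = fun n => y_of (yz_err ys zs n.+1) (row_err ys n.+1) t i + ys t i).
    by apply: cvgD; [exact: cy | exact: cvg_cst].
  by apply/funext => n; rewrite -(inv n).2 subrK.
have cz1 c : z n.+1 c @[n --> U] --> zs' c.
  rewrite (_ : (fun n => _) = fun n => z_of (yz_err ys zs n.+1) (row_err ys n.+1) c + zs c).
    by apply: cvgD; [exact: cz | exact: cvg_cst].
  by apply/funext => n; rewrite -(inv n).1 subrK.
(* The step relations mix the indices [n.+1] and [n.+2], and [U] need not be invariant under the
   shift. Both limits agree because the increments vanish along the whole sequence. *)
have [sy sz] := step_cvg0.
have cy2 t i : y n.+2 t i @[n --> U] --> ys' t i.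
  rewrite -[X in _ --> X]add0r.
  rewrite (_ : (fun n => _) = fun n => (y n.+2 t i - y n.+1 t i) + y n.+1 t i).
    apply: cvgD; last exact: cy1.
    apply: (cvg_along ooU).
    by rewrite (cvg_shiftS (fun n => y n.+1 t i - y n t i)).
  by apply/funext => n; rewrite subrK.
have cz2 c : z n.+2 c @[n --> U] --> zs' c.
  rewrite -[X in _ --> X]add0r.
  rewrite (_ : (fun n => _) = fun n => (z n.+2 c - z n.+1 c) + z n.+1 c).
    apply: cvgD; last exact: cz1.
    apply: (cvg_along ooU).
    by rewrite (cvg_shiftS (fun n => z n.+1 c - z n c)).
  by apply/funext => n; rewrite subrK.
have cr x : resid_at n.+2 x @[n --> U] --> (0 : R).
  apply: (cvg_along ooU).
  by rewrite (cvg_shiftS (fun n => resid_at n.+1 x)) (cvg_shiftS (fun n => resid_at n x));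
    exact: resid_cvg0.
pose us' i := \sum_t ys' t i; pose Vs' c i := D c i + ys' (tg c) i + zs' c.
have cu i : u n.+2 i @[n --> U] --> us' i.
  rewrite -[X in _ --> X]subr0.
  rewrite (_ : (fun n => _) = fun n => \sum_t y n.+2 t i - resid_at n.+2 (inl i)).
    by apply: cvgB; [apply: cvg_sumr => t; exact: cy2 | exact: cr].
  by apply/funext => n; rewrite /resid_at /= /res0; ring.
have cV c i : V n.+2 c i @[n --> U] --> Vs' c i.
  rewrite -[X in _ --> X]addr0.
  rewrite (_ : (fun n => _) = fun n => D c i + y n.+2 (tg c) i + z n.+2 c
      + resid_at n.+2 (inr (c, i))).
    apply: cvgD; last exact: cr.
    by apply: cvgD; [apply: cvgD; [exact: cvg_cst | exact: cy2] | exact: cz2].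
  by apply/funext => n; rewrite /resid_at /= /res; ring.
have bet0 (b : R) (x : nat -> R) : x n @[n --> U] --> b ->
    (beta * x n) @[n --> U] --> beta * b by move=> xb; apply: cvgM => //; exact: cvg_cst.
exists us', Vs', ys', zs', ls', Ls'; split=> //.
  split.
  - apply: (subgrad_closed _ (fun n => uV_step n.+1) cu cV) => [i|c i].
      rewrite -[X in _ --> X]addr0 -[X in _ + X](mulr0 beta); apply: cvgD => //.
      apply: bet0; rewrite -(subrr (us' i)); apply: cvgB => //.
      by apply: cvg_sumr => t.
    rewrite -[X in _ --> X]addr0 -[X in _ + X](mulr0 beta); apply: cvgD => //.
    apply: bet0; have -> : 0 = Vs' c i - D c i - ys' (tg c) i - zs' c by rewrite /Vs'; ring.
    by apply: cvgB => //; apply: cvgB => //; apply: cvgB => //; exact: cvg_cst.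
  - by move=> i; rewrite /res0 subrr.
  - by move=> c i; rewrite /res /Vs'; ring.
  - move=> c; apply: (@cvg_eq_cst U (fun n =>
      \sum_i (L n.+1 c i + beta * res (V n.+2) (y n.+2) (z n.+2) c i))) => [|n]; last first.
      exact: col_step.
    apply: cvg_sumr => i; rewrite -[X in _ --> X]addr0 -[X in _ + X](mulr0 beta).
    by apply: cvgD => //; apply: bet0; exact: (cr (inr (c, i))).
  - move=> t i; apply/eqP; rewrite -subr_eq0; apply/eqP.
    apply: (@cvg_eq_cst U (fun n => \sum_(c | tg c == t)
        (L n.+1 c i + beta * res (V n.+2) (y n.+2) (z n.+2) c i)
      - (l n.+1 i + beta * res0 (u n.+2) (y n.+2) i
        + prox_weight t * (\sum_i y n.+2 t i - \sum_i y n.+1 t i)))) => [|n]; last first.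
      by rewrite row_step subrr.
    apply: cvgB.
      apply: cvg_sumr => c; rewrite -[X in _ --> X]addr0 -[X in _ + X](mulr0 beta).
      by apply: cvgD => //; apply: bet0; exact: (cr (inr (c, i))).
    rewrite -[X in _ --> X]addr0 -[X in _ + X](mulr0 (prox_weight t)); apply: cvgD.
      rewrite -[X in _ --> X]addr0 -[X in _ + X](mulr0 beta).
      by apply: cvgD => //; apply: bet0; exact: (cr (inl i)).
    apply: cvgM; first exact: cvg_cst.
    apply: (cvg_along ooU).
    by rewrite (cvg_shiftS (fun n => \sum_i y n.+1 t i - \sum_i y n t i)); exact: row_step_cvg0.
move=> [i|[c i]]; rewrite /mult_err /=.
  by rewrite -(subrr (ls' i)); apply: cvgB => //; exact: cvg_cst.
by rewrite -(subrr (Ls' c i)); apply: cvgB => //; exact: cvg_cst.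
Qed.

Lemma merit_cvg0 (U : set_system nat) : ProperFilter U -> \oo `<=` U ->
  (forall x, mult_err ls Ls n.+1 x @[n --> U] --> (0 : R)) ->
  (forall t i, y n.+1 t i @[n --> U] --> ys t i) ->
  (forall c, z n.+1 c @[n --> U] --> zs c) ->
  phi n.+1 @[n --> \oo] --> (0 : R).
Proof.
move=> UU ooU cm cy cz.
have sq0 C (x : nat -> R) : x n @[n --> U] --> (0 : R) -> (C * x n ^+ 2) @[n --> U] --> (0 : R).
  move=> x0; rewrite -(mulr0 C); apply: cvgM; first exact: cvg_cst.
  by rewrite -(mulr0 0); exact: cvgM.
have dy0 t i : (y n.+1 t i - ys t i) @[n --> U] --> (0 : R).
  by rewrite -(subrr (ys t i)); apply: cvgB => //; exact: cvg_cst.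
have dz0 c : (z n.+1 c - zs c) @[n --> U] --> (0 : R).
  by rewrite -(subrr (zs c)); apply: cvgB => //; exact: cvg_cst.
have sum0 (J : finType) (x : nat -> J -> R) :
    (forall j, x n j @[n --> U] --> (0 : R)) -> \sum_j x n j @[n --> U] --> (0 : R).
  move=> x0; have E : \sum_(j : J) 0 = 0 :> R by rewrite big1.
  rewrite -[X in _ --> X]E.
  by apply: cvg_sumr => j; exact: x0.
have cg x : yz_err ys zs n.+1 x @[n --> U] --> (0 : R).
  case: x => [i|[c i]]; rewrite /yz_err /yz_map /=; first exact: sum0.
  rewrite -(subr0 0); apply: cvgB; last exact: dz0.
  by rewrite -oppr0; apply: cvgN; exact: dy0.
have cs t : row_err ys n.+1 t @[n --> U] --> (0 : R) by apply: sum0.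
have cr x : resid_at n.+1 x @[n --> U] --> (0 : R).
  apply: (cvg_along ooU).
  by rewrite (cvg_shiftS (fun n => resid_at n x)); exact: resid_cvg0.
have cd t : (row_err ys n.+1 t - row_err ys n t) @[n --> U] --> (0 : R).
  apply: (cvg_along ooU).
  rewrite (_ : (fun n => _) = fun n => \sum_i y n.+1 t i - \sum_i y n t i).
    exact: row_step_cvg0.
  by apply/funext => n; rewrite row_errB.
have cphi : phi n.+1 @[n --> U] --> (0 : R).
  rewrite /phi /merit /lyap -[X in _ --> X](addr0 0); apply: cvgD.
    apply: sum0 => x; rewrite -[X in _ --> X](addr0 0); apply: cvgD; last exact: sq0.
    by rewrite -[X in _ --> X](addr0 0); apply: cvgD; exact: sq0.
  apply: sum0 => t; rewrite -(mulr0 (prox_weight t)); apply: cvgM; first exact: cvg_cst.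
  rewrite -[X in _ --> X](addr0 0).
  by apply: cvgD; rewrite -[X in _ --> X](mulr0 0); apply: cvgM.
apply/cvgr0Pnorm_lt => e e0.
have /cvgr0Pnorm_lt/(_ e e0)/filter_ex[m me] := cphi.
exists m => // n /= mn.
have [p0 _ _ _] := merit_ge n.+1; rewrite ger0_norm //.
exact: le_lt_trans (merit_noninc mn) (le_lt_trans (ler_norm _) me).
Qed.

Lemma cvg_ref : phi n.+1 @[n --> \oo] --> (0 : R) ->
  [/\ forall i, u n i @[n --> \oo] --> us i, forall c i, V n c i @[n --> \oo] --> Vs c i,
      forall t i, y n t i @[n --> \oo] --> ys t i & forall c, z n c @[n --> \oo] --> zs c] /\
  ((forall i, l n i @[n --> \oo] --> ls i) /\
   (forall c i, L n c i @[n --> \oo] --> Ls c i)).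
Proof.
move=> phi0.
have cm x : mult_err ls Ls n x @[n --> \oo] --> (0 : R).
  have C0 : 0 < (tau * beta)^-1 by rewrite invr_gt0 mulr_gt0.
  by rewrite -cvg_shiftS; apply: sqr_cvg0 C0 _ phi0 => n; have [_ /(_ x)] := merit_ge n.+1.
have cg x : yz_err ys zs n x @[n --> \oo] --> (0 : R).
  by rewrite -cvg_shiftS; apply: sqr_cvg0 beta_gt0 _ phi0 => n; have [_ _ /(_ x)] := merit_ge n.+1.
have cs t : row_err ys n t @[n --> \oo] --> (0 : R).
  rewrite -cvg_shiftS; apply: sqr_cvg0 (prox_weight_gt0 t) _ phi0 => n.
  by have [_ _ _ /(_ t)] := merit_ge n.+1.
have z0 c : z_of (fun=> 0) (fun=> 0) c = 0.
  by rewrite /z_of big1 // addr0 oppr0 mul0r.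
have y0 t i : y_of (fun=> 0) (fun=> 0) t i = 0 by rewrite /y_of z0 subr0 oppr0.
have [cz cy] := yz_of_cvg _ cg cs.
have inv n := yz_map_inv (fun t i => y n t i - ys t i) (fun c => z n c - zs c).
have shift (x : nat -> R) b : (x n - b) @[n --> \oo] --> (0 : R) -> x n @[n --> \oo] --> b.
  move=> xb; rewrite -[b]add0r (_ : (fun n => _) = fun n => (x n - b) + b).
    by apply: cvgD => //; exact: cvg_cst.
  by apply/funext => n; rewrite subrK.
have cy1 t i : y n t i @[n --> \oo] --> ys t i.
  apply: shift; rewrite (_ : (fun n => _) = fun n => y_of (yz_err ys zs n) (row_err ys n) t i).
    by rewrite -(y0 t i); exact: cy.
  by apply/funext => n; rewrite (inv n).2.
have cz1 c : z n c @[n --> \oo] --> zs c.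
  apply: shift; rewrite (_ : (fun n => _) = fun n => z_of (yz_err ys zs n) (row_err ys n) c).
    by rewrite -(z0 c); exact: cz.
  by apply/funext => n; rewrite (inv n).1.
split; split=> //.
- move=> i; have -> : us i = \sum_t ys t i - 0.
    by have := kkt_res0 ref i; rewrite /res0 => r0; lra.
  rewrite (_ : (fun n => _) = fun n => \sum_t y n t i - resid_at n (inl i)).
    by apply: cvgB; [apply: cvg_sumr => t; exact: cy1 | exact: resid_cvg0].
  by apply/funext => n; rewrite /resid_at /= /res0; ring.
- move=> c i; have -> : Vs c i = D c i + ys (tg c) i + zs c + 0.
    by have := kkt_res ref c i; rewrite /res => r0; lra.
  rewrite (_ : (fun n => _) = fun n => D c i + y n (tg c) i + z n c + resid_at n (inr (c, i))).
    apply: cvgD; last exact: resid_cvg0.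
    by apply: cvgD; [apply: cvgD; [exact: cvg_cst | exact: cy1] | exact: cz1].
  by apply/funext => n; rewrite /resid_at /= /res; ring.
- by move=> i; apply: shift; exact: (cm (inl i)).
- by move=> c i; apply: shift; exact: (cm (inr (c, i))).
Qed.

End Reference.

Lemma iterates_cvg (rep : T -> Z) : (forall t, tg (rep t) = t) ->
  tau < (1 + Num.sqrt 5) / 2 ->
  exists us Vs ys zs ls Ls, kkt us Vs ys zs ls Ls /\
    ([/\ forall i, u n i @[n --> \oo] --> us i, forall c i, V n c i @[n --> \oo] --> Vs c i,
      forall t i, y n t i @[n --> \oo] --> ys t i & forall c, z n c @[n --> \oo] --> zs c] /\
     ((forall i, l n i @[n --> \oo] --> ls i) /\
      (forall c i, L n c i @[n --> \oo] --> Ls c i))).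
Proof.
move=> repK tau_lt; have [th [th0 mr mg]] := golden_margin tau_gt0 tau_lt.
have [u0 [V0 [y0 [z0 [l0 [L0 ref0]]]]]] := kkt_exists.
have [U [UU ooU]] := @ultraFilterLemma nat \oo _.
have [us [Vs [ys [zs [ls [Ls [ref cm cy cz]]]]]]] :=
  cluster_kkt ref0 th0 mr mg repK UU ooU.
exists us, Vs, ys, zs, ls, Ls; split=> //.
apply: (cvg_ref ref th0 mr mg repK).
exact: (merit_cvg0 ref th0 mr mg repK _ ooU cm cy cz).
Qed.

End Iteration.
End TransportProblem.

(** * Back to matrices *)

Section Flattening.
Variables (R : realType) (N m : nat) (ms : 'I_N -> nat).
Variables (D : forall t, 'M[R]_(m, ms t)) (a : forall t, 'cV[R]_(ms t)).
Hypothesis m_gt0 : (0 < m)%N.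

(* All columns of the [N] plans are put side by side, so that only functions on finite
   types remain. *)
Local Notation Z := {t : 'I_N & 'I_(ms t)}.
Local Notation col t j := (Tagged (fun t : 'I_N => 'I_(ms t)) (i := t) j).

Definition flat_mx (V : forall t, 'M[R]_(m, ms t)) (c : Z) (i : 'I_m) : R :=
  V (tag c) i (tagged c).
Definition flat_cols (z : forall t, 'cV[R]_(ms t)) (c : Z) : R := z (tag c) (tagged c) ord0.
Definition flat_cV (u : 'cV[R]_m) (i : 'I_m) : R := u i ord0.
Definition flat_rows (y : forall t : 'I_N, 'cV[R]_m) (t : 'I_N) (i : 'I_m) : R := y t i ord0.

Definition mx_of (V : Z -> 'I_m -> R) t : 'M[R]_(m, ms t) := \matrix_(i, j) V (col t j) i.
Definition cols_of (z : Z -> R) t : 'cV[R]_(ms t) := \col_j z (col t j).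
Definition cV_of (u : 'I_m -> R) : 'cV[R]_m := \col_i u i.
Definition rows_of (y : 'I_N -> 'I_m -> R) (t : 'I_N) : 'cV[R]_m := \col_i y t i.

Lemma flat_mxK V : flat_mx (mx_of V) = V.
Proof. by apply/funext => -[t j]; apply/funext => i; rewrite /flat_mx mxE. Qed.
Lemma flat_colsK z : flat_cols (cols_of z) = z.
Proof. by apply/funext => -[t j]; rewrite /flat_cols mxE. Qed.
Lemma flat_cVK u : flat_cV (cV_of u) = u.
Proof. by apply/funext => i; rewrite /flat_cV mxE. Qed.
Lemma flat_rowsK y : flat_rows (rows_of y) = y.
Proof. by apply/funext => t; apply/funext => i; rewrite /flat_rows mxE. Qed.

Lemma sum_cols (F : Z -> R) : \sum_c F c = \sum_t \sum_j F (col t j).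
Proof. by rewrite (sig_big_dep _ _ (fun t j => F (col t j))); apply: eq_bigr => -[]. Qed.

Lemma sum_block (F : Z -> R) t : \sum_(c | tag c == t) F c = \sum_j F (col t j).
Proof.
have -> : \sum_j F (col t j) = \sum_(s | s == t) \sum_j F (col s j) by rewrite big_pred1_eq.
rewrite (sig_big_dep _ _ (fun t j => F (col t j))) /=.
by apply: eq_big => [c|[] //]; rewrite andbT.
Qed.

Lemma sum_mxdot (X Y : forall t, 'M[R]_(m, ms t)) :
  \sum_t mxdot (X t) (Y t) = \sum_c \sum_i flat_mx X c i * flat_mx Y c i.
Proof. by rewrite sum_cols; apply: eq_bigr => t _; rewrite /mxdot exchange_big. Qed.

Lemma sum_coldot (z b : forall t, 'cV[R]_(ms t)) :
  \sum_t mxdot (z t) (b t) = \sum_c flat_cols z c * flat_cols b c.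
Proof.
rewrite sum_cols; apply: eq_bigr => t _; rewrite /mxdot.
by apply: eq_bigr => j _; rewrite big_ord1.
Qed.

Lemma dot_cV (x v : 'cV[R]_m) : mxdot x v = \sum_i flat_cV x i * flat_cV v i.
Proof. by apply: eq_bigr => i _; rewrite big_ord1. Qed.

Lemma flat_res0 u y : flat_cV (\sum_t y t - u) = res0 (flat_cV u) (flat_rows y).
Proof. by apply/funext => i; rewrite /flat_cV !mxE summxE. Qed.

Lemma flat_res V y z : flat_mx (fun t => resid (D t) (V t) (y t) (z t))
  = res tag (flat_mx D) (flat_mx V) (flat_rows y) (flat_cols z).
Proof.
apply/funext => -[t j]; apply/funext => i.
by rewrite /flat_mx /resid !mxE !big_ord1 !mxE mulr1 mul1r.
Qed.

(** An empty maximum would be [-oo], whence [m_gt0]. The least-upper-bound form matches the free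
    bound [M'] of [uV_stationary]. *)
Lemma conj_simplexE (u : 'cV[R]_m) : exists M : R,
  [/\ delta_simplex_conj u = M%:E, forall i, flat_cV u i <= M
    & forall M', (forall i, flat_cV u i <= M') -> M <= M'].
Proof.
pose i0 := Ordinal m_gt0.
have [j _ jmax] := @Order.TotalTheory.arg_maxP _ _ _ i0 xpredT (flat_cV u) isT.
exists (flat_cV u j); split=> [|i|M']; [|exact: jmax|exact].
apply/eqP; rewrite eq_le; apply/andP; split.
  by apply: bigmax_le => [|i _]; rewrite ?leNye // lee_fin; exact: jmax.
exact: (le_bigmax _ (fun i => (u i ord0)%:E) j).
Qed.

Lemma delta_plus_real (V : forall t, 'M[R]_(m, ms t)) :
  (forall t, mx_nonneg (V t)) -> (\sum_(t < N) delta_plus (V t) = 0)%E.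
Proof. by move=> V0; rewrite big1 // => t _; rewrite /delta_plus /Defs.indic asboolT. Qed.

Lemma indic_ge0 P : (0 <= Defs.indic R P)%E.
Proof. by rewrite /Defs.indic; case: ifP => // _; rewrite leey. Qed.

Lemma delta_plus_infty (V : forall t, 'M[R]_(m, ms t)) :
  ~ (forall t, mx_nonneg (V t)) -> (\sum_(t < N) delta_plus (V t) = +oo)%E.
Proof.
move=> /existsNP[t Vt]; rewrite (bigD1 t) //= {1}/delta_plus /Defs.indic asboolF //.
by rewrite addye // gt_eqF // (lt_le_trans (ltNy0)) //; apply: sume_ge0 => s _; exact: indic_ge0.
Qed.

Lemma flat_nonneg V : (forall t, mx_nonneg (V t)) <-> forall c i, 0 <= flat_mx V c i.
Proof.
split=> [V0 c i|V0 t i j]; first exact: V0.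
exact: (V0 (col t j) i).
Qed.

Lemma Lbeta_real (beta : R) u V y z lam Lam (M : R) :
  (forall t, mx_nonneg (V t)) -> delta_simplex_conj u = M%:E ->
  Lbeta D a beta u V y z lam Lam
  = (M + smooth (flat_cols a) beta (flat_cols z) (res0 (flat_cV u) (flat_rows y))
           (res tag (flat_mx D) (flat_mx V) (flat_rows y) (flat_cols z))
           (flat_cV lam) (flat_mx Lam))%:E.
Proof.
move=> V0 uM; rewrite /Lbeta uM delta_plus_real // adde0 -EFinD; congr (_ + _)%:E.
have sq (J : finType) (x : J -> R) : \sum_j x j * x j = \sum_j x j ^+ 2.
  by apply: eq_bigr => j _; rewrite expr2.
set Res := fun t => resid (D t) (V t) (y t) (z t).
rewrite /smooth -flat_res -flat_res0 -/Res /frob2 sum_coldot dot_cV.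
rewrite (sum_mxdot Lam Res) dot_cV (sum_mxdot Res Res) big_split -mulr_sumr /=.
rewrite [X in _ = _ + X](eq_bigr (fun c => \sum_i flat_mx Lam c i * flat_mx Res c i
    + beta / 2 * \sum_i flat_mx Res c i * flat_mx Res c i)) => [|c _].
  by rewrite big_split /= -mulr_sumr sq; ring.
by rewrite big_split /= -mulr_sumr sq.
Qed.

Lemma Lbeta_infty (beta : R) u V y z lam Lam :
  ~ (forall t, mx_nonneg (V t)) -> Lbeta D a beta u V y z lam Lam = +oo%E.
Proof.
move=> V0; have [M [uM _ _]] := conj_simplexE u.
by rewrite /Lbeta uM delta_plus_infty.
Qed.

Section KKT.
Variables (us : 'I_m -> R) (Vs : Z -> 'I_m -> R) (ys : 'I_N -> 'I_m -> R) (zs : Z -> R)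
  (ls : 'I_m -> R) (Ls : Z -> 'I_m -> R).
Hypothesis sol : kkt tag (flat_mx D) (flat_cols a) us Vs ys zs ls Ls.

Lemma kkt_gap : \sum_c zs c * flat_cols a c + \sum_c \sum_i flat_mx D c i * Ls c i
  = - \sum_i us i * ls i.
Proof.
rewrite (duality_gap (kkt_res0 sol) (kkt_res sol) (kkt_col sol) (kkt_row sol)).
rewrite big1 ?sub0r // => c _; rewrite big1 // => i _.
by rewrite mulrC (subgrad_compl sol).
Qed.

(** A competitor is paired with the fixed multipliers: its pairing with [ls] is at most its maximum
    and its pairing with [Ls] is nonnegative, with equality in both at the KKT point. *)
Lemma kkt_optimalD :
  optimalD D a (cV_of us) (mx_of Vs) (rows_of ys) (cols_of zs).
Proof.
have feas u V y z : feasD D u V y z <->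
    (forall i, res0 (flat_cV u) (flat_rows y) i = 0) /\
    (forall c i, res tag (flat_mx D) (flat_mx V) (flat_rows y) (flat_cols z) c i = 0).
  rewrite -flat_res -flat_res0; split=> [[h0 h1]|[h0 h1]]; split.
  - by move=> i; rewrite h0 /flat_cV mxE.
  - by move=> [t j] i; rewrite /flat_mx h1 mxE.
  - by apply/matrixP => i j; rewrite ord1 [RHS]mxE; exact: h0.
  - by move=> t; apply/matrixP => i j; rewrite [RHS]mxE; exact: (h1 (col t j)).
split=> [|u V y z].
  apply/feas; rewrite flat_cVK flat_rowsK flat_mxK flat_colsK.
  by split; [exact: kkt_res0 sol | exact: kkt_res sol].
move=> /feas[r0 r1]; rewrite /objD.
have [M [-> _ Mle]] := conj_simplexE (cV_of us).
have [M' [-> uM' _]] := conj_simplexE u.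
have V0 : forall t, mx_nonneg (mx_of Vs t).
  by apply/flat_nonneg; rewrite flat_mxK; exact: (subgrad_V_ge0 sol).
rewrite delta_plus_real //.
have [/[dup] /flat_nonneg V'0 /delta_plus_real ->|/delta_plus_infty ->] :=
    pselect (forall t, mx_nonneg (V t)); last by rewrite leey.
rewrite !adde0 -!EFinD lee_fin !sum_coldot flat_colsK.
have MS : M <= \sum_i us i * ls i.
  apply: Mle => i; rewrite flat_cVK; apply: le_trans (subgrad_u_le sol i) _.
  by rewrite le_eqVlt; apply/orP; left; apply/eqP; apply: eq_bigr => j _; rewrite mulrC.
have uS : \sum_i flat_cV u i * ls i <= M'.
  rewrite -[leRHS]mul1r -(subgrad_l_sum sol) mulr_suml; apply: ler_sum => i _.
  by rewrite mulrC ler_wpM2l // (subgrad_l_ge0 sol).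
have VL : 0 <= \sum_c \sum_i flat_mx V c i * Ls c i.
  apply: sumr_ge0 => c _; apply: sumr_ge0 => i _.
  by rewrite mulr_ge0 // (subgrad_L_ge0 sol).
have := duality_gap r0 r1 (kkt_col sol) (kkt_row sol); have := kkt_gap.
by lra.
Qed.

(** The gap identity with the roles exchanged: the dual point is fixed and bounds the value of every
    competitor of finite value from below. *)
Lemma kkt_optimalP : optimalP D a (cV_of ls) (mx_of Ls).
Proof.
have feas w Pi : feasP a w Pi <->
    (forall t i, \sum_(c | tag c == t) flat_mx Pi c i = flat_cV w i) /\
    (forall c, \sum_i flat_mx Pi c i = flat_cols a c).
  have rowE t i : (Pi t *m ones (ms t)) i ord0 = \sum_(c | tag c == t) flat_mx Pi c i.
    by rewrite sum_block mxE; apply: eq_bigr => j _; rewrite mxE mulr1.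
  have colE t j : ((Pi t)^T *m ones m) j ord0 = \sum_i flat_mx Pi (col t j) i.
    by rewrite mxE; apply: eq_bigr => i _; rewrite !mxE mulr1.
  split=> [h|[hr hc] t]; split.
  - by move=> t i; rewrite -rowE (h t).1.
  - by move=> [t j]; rewrite -colE (h t).2.
  - by apply/matrixP => i j; rewrite ord1 rowE hr.
  - by apply/matrixP => i j; rewrite ord1 colE hc.
have obj w Pi : in_simplex w -> (forall t, mx_nonneg (Pi t)) ->
    objP D w Pi = (\sum_c \sum_i flat_mx D c i * flat_mx Pi c i)%:E.
  move=> w0 Pi0; rewrite /objP /delta_simplex /Defs.indic asboolT // delta_plus_real //.
  by rewrite !add0e sum_mxdot.
have simplex w : in_simplex w <-> \sum_i flat_cV w i = 1 /\ forall i, 0 <= flat_cV w i.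
  suff -> : \sum_i flat_cV w i = ((ones m)^T *m w) ord0 ord0 by [].
  by rewrite mxE; apply: eq_bigr => i _; rewrite !mxE mul1r.
split=> [|w Pi /feas[hr hc]].
  apply/feas; rewrite flat_cVK flat_mxK.
  by split; [exact: kkt_row sol | exact: kkt_col sol].
rewrite obj; last 2 first.
- apply/simplex; rewrite flat_cVK.
  by split; [exact: (subgrad_l_sum sol) | exact: (subgrad_l_ge0 sol)].
- by apply/flat_nonneg; rewrite flat_mxK; exact: (subgrad_L_ge0 sol).
have [w0|w0] := pselect (in_simplex w); last first.
  rewrite /objP /delta_simplex /Defs.indic asboolF // addye ?leey //.
  rewrite gt_eqF // (lt_le_trans (ltNy0)) //; apply: sume_ge0 => t _; exact: indic_ge0.
have [Pi0|/delta_plus_infty Pi0] := pselect (forall t, mx_nonneg (Pi t)); last first.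
  by rewrite /objP Pi0 addey ?leey // /delta_simplex /Defs.indic asboolT.
rewrite obj // lee_fin flat_mxK.
have /simplex[w1 w_ge0] := w0; have /flat_nonneg Pi_ge0 := Pi0.
have uS : \sum_i us i * flat_cV w i <= \sum_i us i * ls i.
  rewrite -[leRHS]mul1r -w1 mulr_suml; apply: ler_sum => i _.
  rewrite mulrC ler_wpM2l //; apply: le_trans (subgrad_u_le sol i) _.
  by rewrite le_eqVlt; apply/orP; left; apply/eqP; apply: eq_bigr => j _; rewrite mulrC.
have VP : 0 <= \sum_c \sum_i Vs c i * flat_mx Pi c i.
  apply: sumr_ge0 => c _; apply: sumr_ge0 => i _.
  by rewrite mulr_ge0 // (subgrad_V_ge0 sol).
have := duality_gap (kkt_res0 sol) (kkt_res sol) hc hr; have := kkt_gap.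
by lra.
Qed.
End KKT.
End Flattening.

(** * Passage to the matrix sequences *)

Lemma cvg_mx_entries (R : realType) (p q : nat) (F : set_system nat)
    (M : nat -> 'M[R]_(p, q)) (A : 'M[R]_(p, q)) : Filter F ->
  (forall i j, M n i j @[n --> F] --> A i j) -> M @ F --> A.
Proof.
move=> FF MA; apply/cvg_ballP => e e0.
have H : \forall n \near F, forall i, forall j, ball (A i j) e (M n i j).
  apply: filter_forall => i; apply: filter_forall => j.
  by have /cvg_ballP := MA i j; apply.
by apply: filterS H => n Hn; split.
Qed.

Theorem theorem7 (R : realType) (N m : nat) (ms : 'I_N -> nat)
  (D : forall t, 'M[R]_(m, ms t)) (a : forall t, 'cV[R]_(ms t))
  (beta tau : R)
  (u : nat -> 'cV[R]_m) (V : nat -> forall t, 'M[R]_(m, ms t))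
  (y : nat -> forall t : 'I_N, 'cV[R]_m) (z : nat -> forall t, 'cV[R]_(ms t))
  (zt : nat -> forall t, 'cV[R]_(ms t))
  (lam : nat -> 'cV[R]_m) (Lam : nat -> forall t, 'M[R]_(m, ms t)) :
  (0 < N)%N -> (0 < m)%N -> (forall t, (0 < ms t)%N) ->
  (forall t, mx_nonneg (a t)) ->
  (forall t, ((ones (ms t))^T *m a t) ord0 ord0 = 1) ->
  0 < beta -> 0 < tau -> tau < (1 + Num.sqrt 5) / 2 ->
  (forall t, mx_nonneg (V 0%N t)) ->
  (* step (1) *)
  (forall k u' V',
     (Lbeta D a beta (u k.+1) (V k.+1) (y k) (z k) (lam k) (Lam k)
      <= Lbeta D a beta u' V' (y k) (z k) (lam k) (Lam k))%E) ->
  (* step (2a) *)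
  (forall k z',
     (Lbeta D a beta (u k.+1) (V k.+1) (y k) (zt k.+1) (lam k) (Lam k)
      <= Lbeta D a beta (u k.+1) (V k.+1) (y k) z' (lam k) (Lam k))%E) ->
  (* step (2b) *)
  (forall k y',
     (Lbeta D a beta (u k.+1) (V k.+1) (y k.+1) (zt k.+1) (lam k) (Lam k)
      <= Lbeta D a beta (u k.+1) (V k.+1) y' (zt k.+1) (lam k) (Lam k))%E) ->
  (* step (2c) *)
  (forall k z',
     (Lbeta D a beta (u k.+1) (V k.+1) (y k.+1) (z k.+1) (lam k) (Lam k)
      <= Lbeta D a beta (u k.+1) (V k.+1) (y k.+1) z' (lam k) (Lam k))%E) ->
  (* step (3) *)
  (forall k, lam k.+1 = lam k + (tau * beta) *: (\sum_(t < N) y k.+1 t - u k.+1)) ->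
  (forall k t, Lam k.+1 t = Lam k t
     + (tau * beta) *: resid (D t) (V k.+1 t) (y k.+1 t) (z k.+1 t)) ->
  (exists (us : 'cV[R]_m) (Vs : forall t, 'M[R]_(m, ms t))
          (ys : forall t : 'I_N, 'cV[R]_m) (zs : forall t, 'cV[R]_(ms t)),
     optimalD D a us Vs ys zs /\
     u @ \oo --> us /\
     (forall t, (fun k => V k t) @ \oo --> Vs t) /\
     (forall t, (fun k => y k t) @ \oo --> ys t) /\
     (forall t, (fun k => z k t) @ \oo --> zs t)) /\
  (exists (ws : 'cV[R]_m) (Pis : forall t, 'M[R]_(m, ms t)),
     optimalP D a ws Pis /\
     lam @ \oo --> ws /\
     (forall t, (fun k => Lam k t) @ \oo --> Pis t)).
Proof.
move=> N_gt0 m_gt0 ms_gt0 a_ge0 a_sum beta_gt0 tau_gt0 tau_lt V0 step1 step2a step2b step2c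
  lam_step Lam_step.
(* A negative entry makes the value in step (1) [+oo], while the competitor with all matrices zero
   has a finite value. Nonnegativity lets the extended-real inequalities be read as real ones. *)
have V_ge0 k : forall t, mx_nonneg (V k t).
  case: k => [//|k]; apply: contrapT => /(Lbeta_infty D a m_gt0 beta (u k.+1) (y k) (z k)
    (lam k) (Lam k)) Linf.
  have := step1 k (u k.+1) (fun t => 0); have [M [uM _ _]] := conj_simplexE m_gt0 (u k.+1).
  by rewrite Linf (Lbeta_real _ _ _ _ _ _ _ _ uM) // => t i j; rewrite mxE.
have I_gt0 : (0 < #|'I_m|)%N by rewrite card_ord.
pose uf k := flat_cV (u k); pose Vf k := flat_mx (V k); pose yf k := flat_rows (y k).
pose zf k := flat_cols (z k); pose lf k := flat_cV (lam k); pose Lf k := flat_mx (Lam k).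
have uV_step k : subgrad (uf k.+1) (Vf k.+1)
    (fun i => lf k i + beta * res0 (uf k.+1) (yf k) i)
    (fun c i => Lf k c i + beta * res tag (flat_mx D) (Vf k.+1) (yf k) (zf k) c i).
  have [M [uM uleM _]] := conj_simplexE m_gt0 (u k.+1).
  apply: (uV_stationary (a := flat_cols a) uleM) => [|u' V' M' u'M' V'0].
    by apply/flat_nonneg; exact: V_ge0.
  (* [M0] is the maximum of [u'], hence at most the arbitrary bound [M']. *)
  have [M0 [uM0 _ M0le]] := conj_simplexE m_gt0 (cV_of u').
  have V'0' : forall t, mx_nonneg (mx_of V' t) by apply/flat_nonneg; rewrite flat_mxK.
  have := step1 k (cV_of u') (mx_of V').
  rewrite (Lbeta_real _ _ _ _ _ _ _ _ uM) // (Lbeta_real _ _ _ _ _ _ _ _ uM0) //.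
  rewrite lee_fin flat_cVK flat_mxK => /le_trans; apply; rewrite lerD2r.
  by apply: M0le => i; rewrite flat_cVK.
(* Stationarity involves multipliers moved with the full step [beta]; the update in step (3) uses
   [tau * beta] instead. *)
pose mult k (c : {t : 'I_N & 'I_(ms t)}) i :=
  Lf k c i + beta * res tag (flat_mx D) (Vf k.+1) (yf k.+1) (zf k.+1) c i.
have step2 k : (forall c, \sum_i mult k c i = flat_cols a c) /\
    (forall t i, \sum_(c | tag c == t) mult k c i = lf k i + beta * res0 (uf k.+1) (yf k.+1) i
       + prox_weight 'I_m (@tag _ (fun t : 'I_N => 'I_(ms t))) beta t * (\sum_i yf k.+1 t i - \sum_i yf k t i)).
  apply: (@sweep_stationary _ _ _ _ tag (flat_mx D) (flat_cols a) I_gt0 beta beta_gt0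
    (uf k.+1) (Vf k.+1) (yf k) (flat_cols (zt k.+1)) (yf k.+1) (zf k.+1) (lf k) (Lf k)) => [z'|y'|z'].
  - have [M [uM _ _]] := conj_simplexE m_gt0 (u k.+1); have := step2a k (cols_of z').
    rewrite (Lbeta_real _ _ _ _ _ _ _ _ uM) // (Lbeta_real _ _ _ _ _ _ _ _ uM) //.
    by rewrite lee_fin lerD2l flat_colsK.
  - have [M [uM _ _]] := conj_simplexE m_gt0 (u k.+1); have := step2b k (rows_of y').
    rewrite (Lbeta_real _ _ _ _ _ _ _ _ uM) // (Lbeta_real _ _ _ _ _ _ _ _ uM) //.
    by rewrite lee_fin lerD2l flat_rowsK.
  - have [M [uM _ _]] := conj_simplexE m_gt0 (u k.+1); have := step2c k (cols_of z').
    rewrite (Lbeta_real _ _ _ _ _ _ _ _ uM) // (Lbeta_real _ _ _ _ _ _ _ _ uM) //.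
    by rewrite lee_fin lerD2l flat_colsK.
have l_step k i : lf k.+1 i = lf k i + tau * beta * res0 (uf k.+1) (yf k.+1) i.
  by rewrite /lf -flat_res0 lam_step /flat_cV !mxE.
have L_step k c i : Lf k.+1 c i = Lf k c i
    + tau * beta * res tag (flat_mx D) (Vf k.+1) (yf k.+1) (zf k.+1) c i.
  by rewrite /Lf -flat_res /flat_mx Lam_step !mxE.
have af_ge0 c : 0 <= flat_cols a c by exact: a_ge0.
have af_sum t : \sum_(c | tag c == t) flat_cols a c = 1.
  by rewrite sum_block -(a_sum t) mxE; apply: eq_bigr => j _; rewrite !mxE mul1r.
have repK t : tag (Tagged (fun t => 'I_(ms t)) (Ordinal (ms_gt0 t))) = t by [].
have [us [Vs [ys [zs [ls [Ls [sol [[cu cV cy cz] [cl cL]]]]]]]]] :=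
  iterates_cvg af_ge0 af_sum I_gt0 beta_gt0 uV_step (fun k => (step2 k).1)
    (fun k => (step2 k).2) l_step L_step tau_gt0 repK tau_lt.
split.
  exists (cV_of us), (mx_of Vs), (rows_of ys), (cols_of zs).
  split; first exact: (kkt_optimalD m_gt0 sol).
  split; first by apply: cvg_mx_entries => i j; rewrite mxE ord1; exact: cu.
  split; first by move=> t; apply: cvg_mx_entries => i j; rewrite mxE; exact: (cV (Tagged _ j)).
  split; first by move=> t; apply: cvg_mx_entries => i j; rewrite mxE ord1; exact: cy.
  by move=> t; apply: cvg_mx_entries => i j; rewrite mxE ord1; exact: (cz (Tagged _ i)).
exists (cV_of ls), (mx_of Ls); split; first exact: (kkt_optimalP sol).
split; first by apply: cvg_mx_entries => i j; rewrite mxE ord1; exact: cl.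
by move=> t; apply: cvg_mx_entries => i j; rewrite mxE; exact: (cL (Tagged _ j)).
Qed.
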